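(* Let $(M,g)$ be a compact connected Riemannian manifold of dimension $n$ whose Ricci tensor satisfies $$Ric(X,X)\ \ge\ (n-1)\,g(X,X)$$ for all tangent vectors $X$. Suppose that the lowest possible non-zero eigenvalue of the Laplacian under this curvature bound, namely $n$, is achieved; that is, there is a smooth function $f\not\equiv 0$ on $M$ with $\triangle f=n f$. Then $(M,g)$ is an Einstein space.
   Context: $\triangle$ denotes the non-negative Laplacian, $\triangle f=-\mathrm{tr}^g(\nabla^2 f)$, where $\nabla$ is the Levi-Civita connection of $g$ and $\nabla^2 f$ is the Hessian of $f$. By Lichnerowicz' theorem, under the stated Ricci bound every non-zero eigenvalue $\lambda$ of $\triangle$ on a compact Riemannian manifold of dimension $n$ satisfies $\lambda\ge n$. The manifold $(M,g)$ is Einstein if the trace-free part $Ric_0=Ric-\frac{S}{n}g$ of the Ricci tensor vanishes, where $S$ is the scalar curvature. *)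

(* Defs.v *)
From mathcomp Require Import all_boot all_order all_algebra.
From mathcomp Require Import all_classical all_reals all_analysis.
From mathcomp Require Import ring.

Set Implicit Arguments.
Unset Strict Implicit.
Unset Printing Implicit Defensive.

Import Order.TTheory GRing.Theory Num.Theory.
Import numFieldNormedType.Exports.

Local Open Scope classical_set_scope.
Local Open Scope ring_scope.

Section Euclidean.
Context {R : realType} {n : nat}.

Definition pderiv (i : 'I_n) (f : 'rV[R]_n -> R) : 'rV[R]_n -> R :=
  fun x => 'D_(delta_mx 0 i) f x.

Definition iter_pderiv (s : seq 'I_n) (f : 'rV[R]_n -> R) : 'rV[R]_n -> R :=
  foldr pderiv f s.

(* C^infty on U; only meant for open U, where it depends only on the values of
   f on U. *)
Definition smooth_on (U : set 'rV[R]_n) (f : 'rV[R]_n -> R) : Prop :=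
  forall (s : seq 'I_n) (x : 'rV[R]_n), U x ->
    {for x, continuous (iter_pderiv s f)} /\
    forall i : 'I_n, derivable (iter_pderiv s f) x (delta_mx 0 i).

Definition bilin (B : 'M[R]_n) (v w : 'rV[R]_n) : R := (v *m B *m w^T) 0 0.

(* In this block, G x is the matrix (g_ij) of a metric at the point with
   coordinates x. *)

(* Coefficients of the Levi-Civita connection:
   nabla_(d_i) d_j = \sum_k (christoffel G k i j) d_k. *)
Definition christoffel (G : 'rV[R]_n -> 'M[R]_n) (k i j : 'I_n)
    (x : 'rV[R]_n) : R :=
  2^-1 * \sum_(l < n) invmx (G x) k l *
    (pderiv i (fun y => G y j l) x + pderiv j (fun y => G y i l) x
     - pderiv l (fun y => G y i j) x).

Definition hessian_mx (G : 'rV[R]_n -> 'M[R]_n) (f : 'rV[R]_n -> R)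
    (x : 'rV[R]_n) : 'M[R]_n :=
  \matrix_(i < n, j < n) (pderiv i (pderiv j f) x
    - \sum_(k < n) christoffel G k i j x * pderiv k f x).

Definition trace_mx (G : 'M[R]_n) (B : 'M[R]_n) : R := \tr (invmx G *m B).

(* riemann G l i j k is the d_l-component of
   R(d_i, d_j) d_k = nabla_i nabla_j d_k - nabla_j nabla_i d_k. *)
Definition riemann (G : 'rV[R]_n -> 'M[R]_n) (l i j k : 'I_n)
    (x : 'rV[R]_n) : R :=
  pderiv i (christoffel G l j k) x - pderiv j (christoffel G l i k) x
  + \sum_(m < n) (christoffel G l i m x * christoffel G m j k x
                  - christoffel G l j m x * christoffel G m i k x).

(* Ric(Y, Z) is the trace of X |-> R(X, Y) Z; it is positive on round spheres. *)
Definition ricci_mx (G : 'rV[R]_n -> 'M[R]_n) (x : 'rV[R]_n) : 'M[R]_n :=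
  \matrix_(j < n, k < n) \sum_(i < n) riemann G i i j k x.

Lemma pderiv_sym (G : 'rV[R]_n -> 'M[R]_n) (k i j : 'I_n) x :
  (\forall y \near x, (G y)^T = G y) ->
  pderiv k (fun y => G y i j) x = pderiv k (fun y => G y j i) x.
Proof.
move=> Gs; apply: near_eq_derive.
by apply: filterS Gs => y Gy; rewrite -[in LHS]Gy mxE.
Qed.

Lemma christoffel_torsion_free (G : 'rV[R]_n -> 'M[R]_n) (k i j : 'I_n) x :
  (\forall y \near x, (G y)^T = G y) ->
  christoffel G k i j x = christoffel G k j i x.
Proof.
move=> Gs; rewrite /christoffel; congr (_ * _); apply: eq_bigr => l _.
by rewrite (pderiv_sym l i j Gs) [pderiv i _ x + _]addrC.
Qed.

Lemma christoffel_metric (G : 'rV[R]_n -> 'M[R]_n) (k i j : 'I_n) x :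
  (\forall y \near x, (G y)^T = G y) -> G x \in unitmx ->
  pderiv k (fun y => G y i j) x =
  \sum_(l < n) (christoffel G l k i x * G x l j
                + christoffel G l k j x * G x i l).
Proof.
move=> Gs Gu; have Gx : (G x)^T = G x by exact: nbhs_singleton Gs.
have lower a b c : \sum_(l < n) christoffel G l a b x * G x l c =
    2^-1 * (pderiv a (fun y => G y b c) x + pderiv b (fun y => G y a c) x
            - pderiv c (fun y => G y a b) x).
  rewrite /christoffel.
  under eq_bigr => l _ do rewrite -mulrA mulr_suml.
  rewrite -mulr_sumr exchange_big /=; congr (_ * _).
  have inv m : \sum_(l < n) G x l c * invmx (G x) l m = (c == m)%:R.
    move: (congr1 (fun B : 'M[R]_n => B c m) (mulmxV Gu)).
    rewrite !mxE => <-; apply: eq_bigr => l _.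
    by congr (_ * _); rewrite -[in LHS]Gx mxE.
  under eq_bigr => m _.
    under eq_bigr => l _ do rewrite mulrAC [_ * G x l c]mulrC.
    rewrite -mulr_suml inv.
    over.
  rewrite (bigD1 c) //= eqxx mul1r big1 ?addr0 // => m /negPf mc.
  by rewrite eq_sym mc mul0r.
rewrite big_split /= lower.
under [X in _ + X]eq_bigr => l _ do rewrite -Gx mxE.
by rewrite lower (pderiv_sym k j i Gs); field.
Qed.

End Euclidean.

Record chart (R : realType) (n : nat) (M : topologicalType) := Chart {
  chart_dom : set M;
  chart_map : M -> 'rV[R]_n;
  chart_inv : 'rV[R]_n -> M;
  chart_dom_open : open chart_dom;
  chart_img_open : open (chart_map @` chart_dom);
  chart_mapK : forall p, chart_dom p -> chart_inv (chart_map p) = p;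
  chart_map_continuous : {within chart_dom, continuous chart_map};
  chart_inv_continuous :
    {within chart_map @` chart_dom, continuous chart_inv} }.

Section Chart.
Context {R : realType} {n : nat} {M : topologicalType}.
Implicit Types c d : chart R n M.

Definition chart_img c : set 'rV[R]_n := chart_map c @` chart_dom c.

Definition overlap c d : set 'rV[R]_n :=
  chart_map c @` (chart_dom c `&` chart_dom d).

(* The l-th component of the change of coordinates from c to d. *)
Definition transition c d (l : 'I_n) : 'rV[R]_n -> R :=
  fun x => chart_map d (chart_inv c x) 0 l.

Definition transition_jac c d (x : 'rV[R]_n) : 'M[R]_n :=
  \matrix_(k < n, l < n) pderiv k (transition c d l) x.

End Chart.

(* The atlas is not required to be maximal. *)
Record smooth_manifold (R : realType) (n : nat) (M : topologicalType) :=
  SmoothManifold {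
  atlas : set (chart R n M);
  manifold_hausdorff : hausdorff_space M;
  manifold_second_countable : @second_countable M;
  atlas_cover : forall p, exists2 c, atlas c & chart_dom c p;
  atlas_smooth : forall c d, atlas c -> atlas d ->
    forall l, smooth_on (overlap c d) (transition c d l) }.

Definition smooth_function (R : realType) (n : nat) (M : topologicalType)
    (S : smooth_manifold R n M) (f : M -> R) : Prop :=
  forall c, atlas S c -> smooth_on (chart_img c) (f \o chart_inv c).

(* A smooth positive definite symmetric (0,2)-tensor field, given by its
   component matrices (g_ij) in the charts of the atlas; metric_change is the
   tensor transformation law.  The values of metric_mx c outside of
   chart_img c are irrelevant. *)
Record riemannian_metric (R : realType) (n : nat) (M : topologicalType)
    (S : smooth_manifold R n M) := RiemannianMetric {
  metric_mx : chart R n M -> 'rV[R]_n -> 'M[R]_n;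
  metric_smooth : forall c, atlas S c ->
    forall i j, smooth_on (chart_img c) (fun x => metric_mx c x i j);
  metric_sym : forall c, atlas S c ->
    forall x, chart_img c x -> (metric_mx c x)^T = metric_mx c x;
  metric_posdef : forall c, atlas S c ->
    forall x, chart_img c x ->
    forall v : 'rV[R]_n, v != 0 -> 0 < bilin (metric_mx c x) v v;
  metric_change : forall c d, atlas S c -> atlas S d ->
    forall x, overlap c d x ->
      metric_mx c x = transition_jac c d x
        *m metric_mx d (chart_map d (chart_inv c x))
        *m (transition_jac c d x)^T }.

(* Tensors at a point p, written in a chart c around p; the component matrices
   of bilinear forms are relative to the coordinate basis of the tangent space
   at p, and a tangent vector at p is the row v of its components. *)
Section Geometry.
Context {R : realType} {n : nat} {M : topologicalType}.
Context {S : smooth_manifold R n M} (g : riemannian_metric S).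
Implicit Types (c : chart R n M) (p : M).

Definition metric c p : 'M[R]_n := metric_mx g c (chart_map c p).

Definition hessian c (f : M -> R) p : 'M[R]_n :=
  hessian_mx (metric_mx g c) (f \o chart_inv c) (chart_map c p).

Definition laplacian c (f : M -> R) p : R :=
  - trace_mx (metric c p) (hessian c f p).

Definition ricci c p : 'M[R]_n := ricci_mx (metric_mx g c) (chart_map c p).

Definition scalar_curvature c p : R := trace_mx (metric c p) (ricci c p).

Definition ricci0 c p : 'M[R]_n :=
  ricci c p - (scalar_curvature c p / n%:R) *: metric c p.

Definition einstein : Prop :=
  forall c p, atlas S c -> chart_dom c p -> ricci0 c p = 0.

Definition ricci_ge (k : R) : Prop :=
  forall c p, atlas S c -> chart_dom c p ->
  forall v : 'rV[R]_n, k * bilin (metric c p) v v <= bilin (ricci c p) v v.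

Definition laplace_eigen (lambda : R) (f : M -> R) : Prop :=
  forall c p, atlas S c -> chart_dom c p -> laplacian c f p = lambda * f p.

End Geometry.

(* Main.v *)
(* Let V = grad f, let H = nabla V and let L = tr Hess = - laplacian, so that
   L f = - n f.  Bochner's formula gives, for P = |V|^2 + f^2,
     L P / 2 = |Hess f + f g|^2 + (Ric - (n - 1) g)(V, V) >= 0,
   so P is constant by the strong maximum principle (which replaces the usual
   integration over M), and Hess f = - f g.  This makes V conformal; commuting
   derivatives, Ric V = (n - 1) V, and the contracted second Bianchi identity
   becomes V(S) = 2 f (S - n (n - 1)).  Hence s = S - n (n - 1) satisfies
   V(s f) = s (f^2 + P) with P a positive constant: s vanishes where s f is
   maximal or minimal, so s f = 0, so s = 0.  As Ric >= (n - 1) g has the same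
   trace as (n - 1) g, they are equal.
   All local computations use the matrices A_i = (Gamma^l_(i k))_(l, k), for
   which the covariant derivative of V along d_i is d_i V + A_i V and the
   curvature is d_i A_j - d_j A_i + A_i A_j - A_j A_i. *)

From HB Require Import structures.
Require Import Defs.
From mathcomp Require Import all_boot all_order all_algebra perm.
From mathcomp Require Import all_classical all_reals all_analysis.
From mathcomp Require Import ring lra.

Set Implicit Arguments.
Unset Strict Implicit.
Unset Printing Implicit Defensive.

Import Order.TTheory GRing.Theory Num.Theory.
Import numFieldNormedType.Exports.

Local Open Scope classical_set_scope.
Local Open Scope ring_scope.

(** * Partial derivatives and smooth functions *)

(** [s] is multiplied by [f] because V(S) alone says too little: where [s] is extremal it gives only
    [f s = 0], and the zeros of [f] stay out of reach. For [s f] the factor [f^2 + P] is positive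
    everywhere. The summand [f^2] in [P] does two jobs: its Laplacian completes |Hess f|^2 to a
    square, and it lowers the coefficient [n] of |V|^2 to the [n - 1] of the Ricci hypothesis. Only
    two scalars must live on [M] itself, |V|^2 and [S]; everything else is an equation inside one
    chart. The invariance of [S] is what calls for the transformation laws of connection, curvature
    and Ricci tensor. Covariant derivatives correct only the matrix indices by connection terms,
    never the indices naming a direction. Antisymmetrised identities do not notice this; in
    contracted ones the leftover connection terms are carried along explicitly until they cancel.
    [smooth_on] speaks of coordinate derivatives only, so total differentiability and the symmetry
    of second derivatives are derived from it first. *)

Section Lines.
Context {R : realType} {V W : normedModType R}.

Lemma line_quotientE (f : V -> W) (z v : V) (s : R) :
  (fun h : R => h^-1 *: (f (h *: v + (z + s *: v)) - f (z + s *: v))) =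
  (fun h : R => h^-1 *: (f (z + (h *: (1 : R) + s) *: v) - f (z + s *: v))).
Proof.
apply/funext => h; congr (_ *: (f _ - _)).
by rewrite [h *: (1 : R)]mulr1 scalerDl addrCA.
Qed.

(** A directional difference quotient is that of a function of one real variable, which makes the
    one-variable theorems available along lines. *)
Lemma is_derive_line (f : V -> W) (z v : V) (s : R) : derivable f (z + s *: v) v ->
  is_derive s 1 (fun t : R => f (z + t *: v)) ('D_v f (z + s *: v)).
Proof.
move=> df; apply: DeriveDef; first by move: df; rewrite /derivable line_quotientE.
by rewrite /derive line_quotientE.
Qed.

Lemma is_derive_line0 (f : V -> W) (x v : V) : derivable (fun t : R => f (x + t *: v)) 0 1 ->
  is_derive x v f ('D_1 (fun t : R => f (x + t *: v)) 0).
Proof.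
have := line_quotientE f x v 0; rewrite {1 2}scale0r addr0 => E.
by move=> df; apply: DeriveDef; [move: df; rewrite /derivable -E|rewrite /derive -E].
Qed.
End Lines.

Section MeanValue.
Context {R : realType} {V : normedModType R}.
Implicit Types (f : V -> R) (x z v : V).

Lemma MVT_line f z v (a : R) :
  (forall t : R, `|t| <= `|a| -> derivable f (z + t *: v) v) ->
  exists2 t : R, `|t| <= `|a| &
    f (z + a *: v) - f z = a * 'D_v f (z + t *: v).
Proof.
move=> df.
have ds (t : R) : `|t| <= `|a| -> is_derive t 1 (fun s : R => f (z + s *: v))
    ('D_v f (z + t *: v)) by move=> /df; exact: is_derive_line.
have dc (b c : R) : (forall t, t \in `[b, c] -> `|t| <= `|a|) ->
    {within `[b, c], continuous (fun s : R => f (z + s *: v))}.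
  move=> bc; apply/continuous_in_subspaceT => s; rewrite inE => sbc.
  have [? _] := ds s (bc s sbc).
  exact/differentiable_continuous/derivable1_diffP.
have [a0|a0] := leP 0 a.
  have sa t : t \in `[0, a] -> `|t| <= `|a|.
    by rewrite in_itv /= => /andP[t0 ta]; rewrite !ger0_norm.
  have [|c c0 E] := @MVT_segment R _ (fun t => 'D_v f (z + t *: v)) _ _ a0 _ (dc _ _ sa).
    by move=> t; rewrite in_itv /= => /andP[? ?]; apply/ds/sa; rewrite in_itv /= !ltW.
  exists c; first exact: sa.
  by move: E; rewrite scale0r addr0 subr0 mulrC.
have sa t : t \in `[a, 0] -> `|t| <= `|a|.
  by rewrite in_itv /= => /andP[t0 ta]; rewrite !ler0_norm ?lerN2 // ltW.
have [|c c0 E] := @MVT_segment R _ (fun t => 'D_v f (z + t *: v)) _ _ (ltW a0) _ (dc _ _ sa).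
  by move=> t; rewrite in_itv /= => /andP[? ?]; apply/ds/sa; rewrite in_itv /= !ltW.
exists c; first exact: sa.
by move: E; rewrite scale0r addr0 => /eqP; rewrite -eqr_opp opprB => /eqP ->; ring.
Qed.
End MeanValue.

Section Partial.
Context {R : realType} {n : nat}.
Implicit Types (f g h : 'rV[R]_n -> R) (x y z v : 'rV[R]_n) (i j : 'I_n).

Lemma row_norm_leP v (e : R) : 0 <= e -> reflect (forall i, `|v 0 i| <= e) (`|v| <= e).
Proof.
move=> e0; rewrite -[`|v|]/(mx_norm v) mx_normrE; apply: (iffP idP).
  by move=> /bigmax_leP[_ H] i; exact: (H (0, i)).
by move=> H; apply/bigmax_leP; split=> // -[a b] _; rewrite /= ord1.
Qed.

Lemma coord_le_norm v i : `|v 0 i| <= `|v|.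
Proof. exact: (row_norm_leP v (normr_ge0 v) _). Qed.

(** The increment is split along a path that changes one coordinate at a time; the mean value
    theorem on each leg and continuity of the partial derivatives bound the error. *)
Lemma C1_differentiable h x :
  (\forall y \near x, forall i, derivable h y (delta_mx 0 i)) ->
  (forall i, {for x, continuous (pderiv i h)}) ->
  differentiable h x.
Proof.
move=> dh ch.
pose df v := \sum_(i < n) v 0 i * pderiv i h x.
have dfl : linear df.
  move=> a u v; rewrite /df scaler_sumr -big_split /=; apply: eq_bigr => i _.
  by rewrite !mxE mulrDl -mulrA.
pose dfL : {linear 'rV[R]_n -> R} := HB.pack df (GRing.isLinear.Build _ _ _ _ df dfl).
have dfc : continuous dfL.
  move=> v; rewrite /= /df; apply: (@cvg_big _ _ _ _ _ _ _ (nbhs v)) => [|i _].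
    exact: add_continuous.
  by apply: cvgM; [exact: coord_continuous | exact: cvg_cst].
have dfo : h \o shift x = cst (h x) + dfL +o_ (0 : 'rV[R]_n) id.
  apply/eqaddoP => e e0.
  (* There are [n] legs, each allowed this share of the error; [n.+1] keeps the share positive when
     [n = 0]. *)
  have e1 : 0 < e / n.+1%:R by rewrite divr_gt0.
  have H : \forall y \near x, forall i, derivable h y (delta_mx 0 i) /\
      `|pderiv i h x - pderiv i h y| <= e / n.+1%:R.
    near=> y => i; split; first by move: i; near: y.
    move: i; near: y; apply: filter_forall => i.
    by have /cvgrPdist_le/(_ _ e1) := ch i.
  move/nbhs_ballP: H => [r r0 Hr].
  apply/nbhs_ballP; exists r => //= v; rewrite -ball_normE /= sub0r normrN => vr.
  have Hr' u : `|u| <= `|v| -> forall i, derivable h (x + u) (delta_mx 0 i) /\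
      `|pderiv i h x - pderiv i h (x + u)| <= e / n.+1%:R.
    move=> uv i; apply: Hr; rewrite -ball_normE /= opprD addNKr normrN.
    exact: le_lt_trans vr.
  (* [w k] keeps the first [k] coordinates of [v]: the corners of the path from [x] to [x + v]. *)
  pose w k : 'rV[R]_n := \row_i (if (i < k)%N then v 0 i else 0).
  have wS (i : 'I_n) : w i.+1 = w i + v 0 i *: delta_mx 0 i.
    apply/rowP => j; rewrite !mxE eqxx /= ltnS leq_eqVlt.
    have [->|ji] := eqVneq j i; first by rewrite eqxx ltnn mulr1 add0r.
    by rewrite (negPf (ji : (j : nat) != i)) mulr0 addr0.
  have wn : w n = v by apply/rowP => j; rewrite !mxE ltn_ord.
  have w0 : w 0%N = 0 by apply/rowP => j; rewrite !mxE.
  have tele : h (x + v) - h x = \sum_(i < n) (h (x + w i.+1) - h (x + w i)).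
    rewrite -[X in X = _]/(h (x + v) - h x) -{1}wn -[in X in _ - X](addr0 x) -w0.
    by rewrite -(telescope_sumr (fun k => h (x + w k)) (leq0n n)) big_mkord.
  have -> : (h \o shift x - (cst (h x) + dfL)) v =
      \sum_(i < n) (h (x + w i.+1) - h (x + w i) - v 0 i * pderiv i h x).
    rewrite sumrB -tele /= -[LHS]/(h (v + x) - (h x + df v)) /df.
    by rewrite [v + x]addrC opprD addrA.
  apply: (@le_trans _ _ (\sum_(i < n) `|v| * (e / n.+1%:R))).
    apply: (le_trans (ler_norm_sum _ _ _)); apply: ler_sum => i _.
    (* In the sup norm no point of the path is farther from [x] than [x + v] is. *)
    have nw t : `|t| <= `|v 0 i| -> `|w i + t *: delta_mx 0 i| <= `|v|.
      move=> tv; apply/row_norm_leP => // j; rewrite !mxE eqxx /=.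
      have [->|ji] := eqVneq j i.
        by rewrite ltnn mulr1 add0r (le_trans tv) // coord_le_norm.
      rewrite mulr0 addr0; case: ifP => _; first exact: coord_le_norm.
      by rewrite normr0.
    have [t|t tv E] := @MVT_line R _ h (x + w i) (delta_mx 0 i) (v 0 i).
      by rewrite -addrA => /nw/Hr'/(_ i)[].
    rewrite wS addrA E -mulrBr normrM ler_pM ?coord_le_norm // distrC -addrA.
    by have [_] := Hr' _ (nw _ tv) i.
  rewrite sumr_const card_ord -[_ *+ n]mulr_natr.
  have -> : `|v| * (e / n.+1%:R) * n%:R = e * `|v| * (n%:R / n.+1%:R) by ring.
  by rewrite ler_piMr ?mulr_ge0 ?(ltW e0) // ler_pdivrMr // mul1r ler_nat.
have E := diff_unique dfc dfo.
by apply/diff_locallyP; rewrite E.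
Unshelve. all: by end_near. Qed.

Lemma differentiable_deriveE h x v : differentiable h x ->
  'D_v h x = \sum_(i < n) v 0 i * pderiv i h x.
Proof.
move=> dh; rewrite deriveE // {1}[v]row_sum_delta linear_sum; apply: eq_bigr => i _.
by rewrite linearZ /pderiv deriveE.
Qed.
End Partial.

(** * Symmetry of second partial derivatives *)

Section Schwarz.
Context {R : realType} {n : nat}.
Implicit Types (f : 'rV[R]_n -> R) (x y z v w : 'rV[R]_n) (i j : 'I_n).

Lemma is_derive_translate f w y v : derivable f (y + w) v ->
  is_derive y v (fun z => f (z + w)) ('D_v f (y + w)).
Proof.
have E : (fun h : R => h^-1 *: (((fun z => f (z + w)) \o shift y) (h *: v) - f (y + w)))
    = (fun h : R => h^-1 *: ((f \o shift (y + w)) (h *: v) - f (y + w))).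
  by apply/funext => h /=; rewrite addrA.
move=> df; apply: DeriveDef; first by rewrite /derivable E.
by rewrite /derive E.
Qed.

Lemma norm_delta_le i (t : R) : `|t *: delta_mx 0 i : 'rV[R]_n| <= `|t|.
Proof.
apply/row_norm_leP => // j; rewrite !mxE eqxx /= normrM.
by case: (j == i); rewrite ?normr1 ?normr0 ?mulr1 ?mulr0.
Qed.

(** The mean value theorem is used twice: along [ei] for the difference of [f] and its translate by
    [t *: ej], then along [ej] for [pderiv i f]. The point found is [s *: ei + s' *: ej], whence the
    radius [|t| + |t|]. *)
Lemma second_difference f x i j (t : R) :
  (forall u, `|u| <= `|t| + `|t| -> derivable f (x + u) (delta_mx 0 i) /\
     derivable (pderiv i f) (x + u) (delta_mx 0 j)) ->
  exists2 u, `|u| <= `|t| + `|t| &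
    f (x + t *: delta_mx 0 i + t *: delta_mx 0 j) - f (x + t *: delta_mx 0 i)
    - (f (x + t *: delta_mx 0 j) - f x) =
    t * (t * pderiv j (pderiv i f) (x + u)).
Proof.
move=> H; set ei := delta_mx 0 i; set ej := delta_mx 0 j.
have small (a b : R) : `|a| <= `|t| -> `|b| <= `|t| -> `|a *: ei + b *: ej| <= `|t| + `|t|.
  move=> ha hb; apply: le_trans (ler_normD _ _) _.
  by apply: lerD; apply: le_trans (norm_delta_le _ _) _.
have dphi (s : R) : `|s| <= `|t| -> is_derive (x + s *: ei) ei
    ((fun y => f (y + t *: ej)) - f)
    (pderiv i f (x + s *: ei + t *: ej) - pderiv i f (x + s *: ei)).
  move=> st; apply: is_deriveB.
    by apply: is_derive_translate; rewrite -addrA; apply: (H _ _).1; exact: small.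
  apply: derivableP; apply: (H _ _).1.
  by have := small s 0 st; rewrite scale0r addr0 normr0; apply.
have [s' st'|s st E] := @MVT_line R _ ((fun y => f (y + t *: ej)) - f) x ei t.
  by have [] := dphi s' st'.
have [_ D] := dphi s st; rewrite D in E.
have [s' st'|s' st' E'] := @MVT_line R _ (pderiv i f) (x + s *: ei) ej t.
  by rewrite -addrA; apply: (H _ _).2; exact: small.
exists (s *: ei + s' *: ej); first exact: small.
by rewrite E' in E; rewrite addrA.
Qed.

(** The second difference is symmetric in the two directions, so each mixed derivative takes the
    same value at some point near [x]; continuity brings both back to [x]. *)
Lemma pderiv_comm f x i j :
  (\forall y \near x, forall k, derivable f y (delta_mx 0 k) /\
     forall l, derivable (pderiv k f) y (delta_mx 0 l)) ->
  {for x, continuous (pderiv i (pderiv j f))} ->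
  {for x, continuous (pderiv j (pderiv i f))} ->
  pderiv i (pderiv j f) x = pderiv j (pderiv i f) x.
Proof.
move=> H ci cj; apply/eqP; rewrite -subr_eq0 -normr_le0; apply/ler_addgt0Pl => e e0.
rewrite addr0.
have e2 : 0 < e / 2 by rewrite divr_gt0.
have /cvgrPdist_le/(_ _ e2) Hi := ci; have /cvgrPdist_le/(_ _ e2) Hj := cj.
have HH : \forall y \near x, (forall k, derivable f y (delta_mx 0 k) /\
     forall l, derivable (pderiv k f) y (delta_mx 0 l)) /\
    `|pderiv i (pderiv j f) x - pderiv i (pderiv j f) y| <= e / 2 /\
    `|pderiv j (pderiv i f) x - pderiv j (pderiv i f) y| <= e / 2.
  exact: filterI H (filterI Hi Hj).
move/nbhs_ballP: HH => [r /= r0 Hr].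
(* The intermediate points lie within [2 * t = r / 2] of [x], hence in the ball of radius [r]. *)
pose t := r / 4.
have t0 : 0 < t by rewrite divr_gt0.
have Hr' u : `|u| <= `|t| + `|t| -> ball x r (x + u).
  move=> ut; rewrite -ball_normE /= opprD addNKr normrN (le_lt_trans ut) //.
  by rewrite (gtr0_norm t0) /t; lra.
have [u' ut'|u ut E] := @second_difference f x i j t.
  by have [/(_ i)[di dd] _] := Hr _ (Hr' _ ut'); exact: conj di (dd j).
have [u' ut'|v vt F] := @second_difference f x j i t.
  by have [/(_ j)[di dd] _] := Hr _ (Hr' _ ut'); exact: conj di (dd i).
have EF : pderiv j (pderiv i f) (x + u) = pderiv i (pderiv j f) (x + v).
  apply: (mulfI (lt0r_neq0 t0)); apply: (mulfI (lt0r_neq0 t0)).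
  apply: etrans (esym E) _; apply: etrans _ F.
  rewrite (addrAC x (t *: delta_mx 0 i) (t *: delta_mx 0 j)).
  by rewrite !opprB addrACA [RHS]addrACA; congr (_ + _); rewrite addrC.
have [_ [_ Hu]] := Hr _ (Hr' _ ut); have [_ [Hv _]] := Hr _ (Hr' _ vt).
rewrite EF in Hu.
have := lerD Hv Hu; rewrite -splitr; apply: le_trans.
rewrite [X in _ <= _ + X]distrC; exact: ler_distD.
Qed.
End Schwarz.

(** * Closure properties of smooth functions *)

Section Ck.
Context {R : realType} {n : nat}.
Implicit Types (f g : 'rV[R]_n -> R) (x y : 'rV[R]_n) (i j : 'I_n).
Implicit Types (U : set 'rV[R]_n).

Definition cont_derivable U f := forall x, U x ->
  {for x, continuous f} /\ forall i, derivable f x (delta_mx 0 i).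

(** Finite orders permit induction: the product, inverse and exponential rules express a derivative
    through the function itself at one order less, which iterated derivatives along a list do not
    show. *)
Fixpoint Ck k U f := cont_derivable U f /\
  if k is k'.+1 then forall i, Ck k' U (pderiv i f) else True.

Lemma iter_pderiv_rcons s i f : iter_pderiv (rcons s i) f = iter_pderiv s (pderiv i f).
Proof. by rewrite /iter_pderiv foldr_rcons. Qed.

Lemma smooth_on_pderiv U i f : smooth_on U f -> smooth_on U (pderiv i f).
Proof. by move=> sf s x Ux; have := sf (rcons s i) x Ux; rewrite iter_pderiv_rcons. Qed.

Lemma smooth_onP U f : smooth_on U f <-> forall k, Ck k U f.
Proof.
split=> [sf k|].
  elim: k f sf => [|k IH] f sf; split=> //; [exact: (sf [::])|exact: (sf [::])|].
  by move=> i; exact/IH/smooth_on_pderiv.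
(* [foldr] applies the last entry of the list first, so the list is peeled from its end to follow
   the recursion of [Ck]. *)
move=> H s; elim/last_ind: s f H => [|s i IH] f H x Ux.
  by have [/(_ x Ux)] := H 0%N.
by rewrite iter_pderiv_rcons; apply: IH => // k; have [_ Hi] := H k.+1; exact: Hi.
Qed.

Lemma CkW k U f : Ck k.+1 U f -> Ck k U f.
Proof. by elim: k f => [|k IH] f [cf H]; split=> // i; exact/IH/H. Qed.

Context (U : set 'rV[R]_n) (oU : open U).

Lemma pderiv_on i f g x : (forall y, U y -> f y = g y) -> U x ->
  pderiv i f x = pderiv i g x.
Proof.
move=> fg Ux; apply: near_eq_derive.
by apply: filterS (open_nbhs_nbhs (conj oU Ux)) => y /fg.
Qed.

Lemma cont_derivable_eq f g : (forall y, U y -> f y = g y) ->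
  cont_derivable U f -> cont_derivable U g.
Proof.
move=> fg cf x Ux; have [c d] := cf x Ux.
have nr : \near x, f x = g x by apply: filterS (open_nbhs_nbhs (conj oU Ux)) => y /fg.
split=> [|i]; last exact: near_eq_derivable (d i).
rewrite /prop_for /continuous_at -fg //; apply: cvg_trans c.
exact: near_eq_cvg nr.
Qed.

Lemma Ck_eq k f g : (forall y, U y -> f y = g y) -> Ck k U f -> Ck k U g.
Proof.
elim: k f g => [|k IH] f g fg [cf H]; (split; first exact: cont_derivable_eq cf) => //.
by move=> i; apply: IH (H i) => y Uy; exact: pderiv_on.
Qed.

Lemma Ck_cst k (a : R) : Ck k U (fun=> a).
Proof.
have c (b : R) : cont_derivable U (fun=> b).
  by move=> x _; split=> [|i]; [exact: cst_continuous|exact: derivable_cst].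
elim: k a => [|k IH] a; split=> // i; rewrite (_ : pderiv _ _ = fun=> 0) //.
by apply/funext => x; exact: derive_cst.
Qed.

Lemma CkD k f g : Ck k U f -> Ck k U g -> Ck k U (fun x => f x + g x).
Proof.
have c f' g' : cont_derivable U f' -> cont_derivable U g' ->
    cont_derivable U (fun x => f' x + g' x).
  move=> cf cg x Ux; have [? df] := cf x Ux; have [? dg] := cg x Ux.
  split=> [|i]; first exact: continuousD.
  exact: derivableD (df i) (dg i).
elim: k f g => [|k IH] f g [cf df] [cg dg]; (split; first exact: c) => // i.
apply: Ck_eq (IH _ _ (df i) (dg i)) => x Ux; rewrite /pderiv.
by rewrite -[RHS]/('D_(delta_mx 0 i) (f + g) x) deriveD //; [exact: (cf x Ux).2|exact: (cg x Ux).2].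
Qed.

Lemma CkM k f g : Ck k U f -> Ck k U g -> Ck k U (fun x => f x * g x).
Proof.
have c f' g' : cont_derivable U f' -> cont_derivable U g' ->
    cont_derivable U (fun x => f' x * g' x).
  move=> cf cg x Ux; have [? df] := cf x Ux; have [? dg] := cg x Ux.
  split=> [|i]; first exact: continuousM.
  exact: derivableM (df i) (dg i).
elim: k f g => [|k IH] f g Hf Hg.
  by move: Hf Hg => [cf _] [cg _]; split; first exact: c.
have [cf df] := Hf; have [cg dg] := Hg; (split; first exact: c) => // i.
apply: Ck_eq (CkD (IH _ _ (CkW Hf) (dg i)) (IH _ _ (CkW Hg) (df i))) => x Ux.
by rewrite /pderiv -[RHS]/('D_(delta_mx 0 i) (f * g) x) deriveM //;
  [exact: (cf x Ux).2|exact: (cg x Ux).2].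
Qed.

Lemma CkV k f : (forall x, U x -> f x != 0) -> Ck k U f -> Ck k U (fun x => (f x)^-1).
Proof.
move=> f0.
have c : cont_derivable U f -> cont_derivable U (fun x => (f x)^-1).
  move=> cf x Ux; have [? df] := cf x Ux.
  split=> [|i]; first by apply: continuousV => //; exact: f0.
  by apply: derivableV (df i); exact: f0.
elim: k => [|k IH] Hf; first by case: Hf => cf _; split; first exact: c.
have [cf df] := Hf; (split; first exact: c) => // i.
apply: (@Ck_eq k (fun x => (-1) * ((f x)^-1 * (f x)^-1) * pderiv i f x)).
  move=> x Ux; rewrite /pderiv deriveV ?f0 //; last exact: (cf x Ux).2.
  by rewrite -exprVn expr2 mulN1r.
apply: CkM (df i); apply: CkM; first exact: Ck_cst.
by apply: CkM; apply: IH; exact: CkW.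
Qed.

Lemma pderiv_comp1 i (phi : R -> R) f x : derivable f x (delta_mx 0 i) ->
  derivable phi (f x) 1 ->
  derivable (phi \o f) x (delta_mx 0 i) /\
  pderiv i (phi \o f) x = 'D_1 phi (f x) * pderiv i f x.
Proof.
set v := delta_mx 0 i => df dphi.
pose g (t : R) := f (x + t *: v).
have g0 : g 0 = f x by rewrite /g scale0r addr0.
have [dg Dg] : is_derive (0 : R) 1 g ('D_v f (x + (0 : R) *: v)).
  by apply: is_derive_line; rewrite scale0r addr0.
have dpg : derivable (phi \o g) 0 1.
  apply/derivable1_diffP; apply: differentiable_comp; first exact/derivable1_diffP.
  by rewrite g0; exact: (derivable1_diffP phi (f x)).1 dphi.
have E : (fun h : R => h^-1 *: (((phi \o f) \o shift x) (h *: v) - (phi \o f) x)) =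
    (fun h : R => h^-1 *: (((phi \o g) \o shift 0) (h *: 1) - (phi \o g) 0)).
  apply/funext => h.
  by rewrite /g /= [h *: (1 : R)]mulr1 !addr0 scale0r addr0 [x + _]addrC.
split; first by move: dpg; rewrite /derivable E.
have := @derive1_comp _ g phi 0 dg; rewrite g0 => /(_ dphi).
rewrite !derive1E Dg scale0r addr0 => <-.
by rewrite /pderiv /derive E.
Qed.

Lemma Ck_expR k f : Ck k U f -> Ck k U (fun x => expR (f x)).
Proof.
have c f' : cont_derivable U f' -> cont_derivable U (fun x => expR (f' x)).
  move=> cf x Ux; have [? df] := cf x Ux; split=> [|i].
    by apply: continuous_comp => //; exact: continuous_expR.
  by have [] := pderiv_comp1 (df i) (@derivable_expR R (f' x)).
elim: k => [|k IH] Hf; first by case: Hf => cf _; split; first exact: c.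
have [cf df] := Hf; (split; first exact: c) => // i.
apply: Ck_eq (CkM (IH (CkW Hf)) (df i)) => x Ux.
have [_ ->] := pderiv_comp1 ((cf x Ux).2 i) (@derivable_expR R (f x)).
by have E := @derive_expR R; move: (congr1 (fun h : R -> R => h (f x)) E) => /= ->.
Qed.

Lemma derive_coord v x j : 'D_v (fun y : 'rV[R]_n => y 0 j) x = v 0 j.
Proof.
have := @derive_mx R 'rV[R]_n 1 n id x v (@derivable_id _ _ x v).
by rewrite derive_id => /matrixP/(_ 0 j); rewrite mxE.
Qed.

Lemma smooth_cst (a : R) : smooth_on U (fun=> a).
Proof. by apply/smooth_onP => k; exact: Ck_cst. Qed.

Lemma smooth_coord j : smooth_on U (fun x => x 0 j).
Proof.
have c : cont_derivable U (fun x => x 0 j).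
  move=> x _; split=> [|i]; first exact: coord_continuous.
  by apply: diff_derivable; exact: differentiable_coord.
apply/smooth_onP => -[|k]; split=> // i.
rewrite (_ : pderiv _ _ = fun=> (delta_mx 0 i : 'rV[R]_n) 0 j); first exact: Ck_cst.
by apply/funext => x; exact: derive_coord.
Qed.

Lemma smooth_eq f g : (forall x, U x -> f x = g x) -> smooth_on U f -> smooth_on U g.
Proof. by move=> fg /smooth_onP sf; apply/smooth_onP => k; exact: Ck_eq (sf k). Qed.

Lemma smoothD f g : smooth_on U f -> smooth_on U g -> smooth_on U (fun x => f x + g x).
Proof.
by move=> /smooth_onP sf /smooth_onP sg; apply/smooth_onP => k; exact: CkD.
Qed.

Lemma smoothM f g : smooth_on U f -> smooth_on U g -> smooth_on U (fun x => f x * g x).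
Proof.
by move=> /smooth_onP sf /smooth_onP sg; apply/smooth_onP => k; exact: CkM.
Qed.

Lemma smoothV f : (forall x, U x -> f x != 0) -> smooth_on U f ->
  smooth_on U (fun x => (f x)^-1).
Proof. by move=> f0 /smooth_onP sf; apply/smooth_onP => k; exact: CkV. Qed.

Lemma smooth_expR f : smooth_on U f -> smooth_on U (fun x => expR (f x)).
Proof. by move=> /smooth_onP sf; apply/smooth_onP => k; exact: Ck_expR. Qed.

Lemma smoothN f : smooth_on U f -> smooth_on U (fun x => - f x).
Proof.
move=> sf; apply: smooth_eq (smoothM (smooth_cst (-1)) sf) => x _.
by rewrite mulN1r.
Qed.

Lemma smoothB f g : smooth_on U f -> smooth_on U g -> smooth_on U (fun x => f x - g x).
Proof. by move=> sf sg; apply: smoothD (smoothN sg). Qed.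

Lemma smooth_sum (I : Type) (r : seq I) (P : pred I) (F : I -> 'rV[R]_n -> R) :
  (forall a, P a -> smooth_on U (F a)) -> smooth_on U (fun x => \sum_(a <- r | P a) F a x).
Proof.
move=> sF; elim: r => [|a r IH].
  by apply: smooth_eq (smooth_cst 0) => x _; rewrite big_nil.
case Pa: (P a); last by apply: smooth_eq IH => x _; rewrite big_cons Pa.
by apply: smooth_eq (smoothD (sF a Pa) IH) => x _; rewrite big_cons Pa.
Qed.

Lemma smooth_prod (I : Type) (r : seq I) (P : pred I) (F : I -> 'rV[R]_n -> R) :
  (forall a, P a -> smooth_on U (F a)) -> smooth_on U (fun x => \prod_(a <- r | P a) F a x).
Proof.
move=> sF; elim: r => [|a r IH].
  by apply: smooth_eq (smooth_cst 1) => x _; rewrite big_nil.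
case Pa: (P a); last by apply: smooth_eq IH => x _; rewrite big_cons Pa.
by apply: smooth_eq (smoothM (sF a Pa) IH) => x _; rewrite big_cons Pa.
Qed.

Lemma smooth_derivable f x i : smooth_on U f -> U x -> derivable f x (delta_mx 0 i).
Proof. by move=> sf Ux; exact: (sf [::] x Ux).2. Qed.

Lemma smooth_continuous f x : smooth_on U f -> U x -> {for x, continuous f}.
Proof. by move=> sf Ux; exact: (sf [::] x Ux).1. Qed.

Lemma smooth_differentiable f x : smooth_on U f -> U x -> differentiable f x.
Proof.
move=> sf Ux; apply: C1_differentiable.
  by apply: filterS (open_nbhs_nbhs (conj oU Ux)) => y Uy i; exact: smooth_derivable.
by move=> i; apply: smooth_continuous Ux; exact: smooth_on_pderiv.
Qed.

Lemma smooth_pderivC f x i j : smooth_on U f -> U x ->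
  pderiv i (pderiv j f) x = pderiv j (pderiv i f) x.
Proof.
move=> sf Ux; apply: pderiv_comm; last 2 first.
1,2: by apply: smooth_continuous Ux; do 2! apply: smooth_on_pderiv.
apply: filterS (open_nbhs_nbhs (conj oU Ux)) => y Uy k.
by split=> [|l]; [exact: smooth_derivable sf Uy|exact: smooth_derivable (smooth_on_pderiv k sf) Uy].
Qed.
End Ck.

(** * Entrywise calculus of matrix-valued functions *)

HB.lock Definition pd {R : realType} {n : nat} (i : 'I_n) (f : 'rV[R]_n -> R)
  (x : 'rV[R]_n) : R := pderiv i f x.

HB.lock Definition dM {R : realType} {n m p : nat} (x : 'rV[R]_n) (i : 'I_n)
  (F : 'rV[R]_n -> 'M[R]_(m, p)) : 'M[R]_(m, p) :=
  \matrix_(a, b) pd i (fun y => F y a b) x.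

Section MatrixCalculus.
Context {R : realType} {n : nat}.
Implicit Types (f g : 'rV[R]_n -> R) (x y : 'rV[R]_n) (i j : 'I_n).

Section Pointwise.
Context (x : 'rV[R]_n) (i : 'I_n).
Local Notation D f := (derivable f x (delta_mx 0 i)).

Lemma pdE f : pd i f x = pderiv i f x.
Proof. by rewrite unlock. Qed.

Lemma pd_cst (a : R) : pd i (fun=> a) x = 0.
Proof. by rewrite pdE; exact: derive_cst. Qed.

Lemma pdD f g : D f -> D g ->
  pd i (fun y => f y + g y) x = pd i f x + pd i g x.
Proof. by rewrite !pdE; exact: deriveD. Qed.

Lemma pdN f : D f -> pd i (fun y => - f y) x = - pd i f x.
Proof. by rewrite !pdE; exact: deriveN. Qed.

Lemma pdM f g : D f -> D g ->
  pd i (fun y => f y * g y) x = pd i f x * g x + f x * pd i g x.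
Proof.
move=> df dg; rewrite !pdE; apply: etrans (deriveM df dg) _; apply: etrans (addrC _ _) _.
exact: congr2 (mulrC _ _) erefl.
Qed.

Lemma derivable_eq f g : f =1 g -> D f -> D g.
Proof. by move=> /funext ->. Qed.

Lemma pd_eq f g : f =1 g -> pd i f x = pd i g x.
Proof. by move=> /funext ->. Qed.

Lemma derivable_bigsum m (F : 'I_m -> 'rV[R]_n -> R) :
  (forall k, D (F k)) -> D (fun y => \sum_(k < m) F k y).
Proof.
move=> dF; rewrite (_ : (fun _ => _) = \sum_(k < m) F k); first exact: derivable_sum.
by apply/funext => y; rewrite fct_sumE.
Qed.

Lemma pd_sum m (F : 'I_m -> 'rV[R]_n -> R) : (forall k, D (F k)) ->
  pd i (fun y => \sum_(k < m) F k y) x = \sum_(k < m) pd i (F k) x.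
Proof.
move=> dF; rewrite (_ : (fun y => \sum_(k < m) F k y) = \sum_(k < m) F k).
  rewrite pdE; apply: etrans (derive_sum dF) _.
  by apply: eq_bigr => k _; rewrite pdE.
by apply/funext => y; rewrite fct_sumE.
Qed.

Definition derivable_mx m p (F : 'rV[R]_n -> 'M[R]_(m, p)) :=
  forall a b, D (fun y => F y a b).

Lemma dME m p (F : 'rV[R]_n -> 'M[R]_(m, p)) a b : dM x i F a b = pd i (fun y => F y a b) x.
Proof. by rewrite unlock mxE. Qed.

Lemma derivable_mxD m p (F H : 'rV[R]_n -> 'M[R]_(m, p)) :
  derivable_mx F -> derivable_mx H -> derivable_mx (fun y => F y + H y).
Proof.
move=> dF dH a b; apply: derivable_eq (derivableD (dF a b) (dH a b)) => y.
by rewrite mxE.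
Qed.

Lemma dMD m p (F H : 'rV[R]_n -> 'M[R]_(m, p)) :
  derivable_mx F -> derivable_mx H -> dM x i (fun y => F y + H y) = dM x i F + dM x i H.
Proof.
move=> dF dH; apply/matrixP => a b; rewrite dME mxE !dME -(pdD (dF a b) (dH a b)).
by apply: pd_eq => y; rewrite mxE.
Qed.

Lemma derivable_mxN m p (F : 'rV[R]_n -> 'M[R]_(m, p)) :
  derivable_mx F -> derivable_mx (fun y => - F y).
Proof.
by move=> dF a b; apply: derivable_eq (derivableN (dF a b)) => y; rewrite mxE.
Qed.

Lemma dMN m p (F : 'rV[R]_n -> 'M[R]_(m, p)) :
  derivable_mx F -> dM x i (fun y => - F y) = - dM x i F.
Proof.
move=> dF; apply/matrixP => a b; rewrite dME mxE dME -(pdN (dF a b)).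
by apply: pd_eq => y; rewrite mxE.
Qed.

Lemma derivable_mxM m p q (F : 'rV[R]_n -> 'M[R]_(m, p)) (H : 'rV[R]_n -> 'M[R]_(p, q)) :
  derivable_mx F -> derivable_mx H -> derivable_mx (fun y => F y *m H y).
Proof.
move=> dF dH a b.
apply: (@derivable_eq (fun y => \sum_k F y a k * H y k b)); first by move=> y; rewrite mxE.
by apply: derivable_bigsum => k; exact: derivableM (dF a k) (dH k b).
Qed.

Lemma dMM m p q (F : 'rV[R]_n -> 'M[R]_(m, p)) (H : 'rV[R]_n -> 'M[R]_(p, q)) :
  derivable_mx F -> derivable_mx H ->
  dM x i (fun y => F y *m H y) = dM x i F *m H x + F x *m dM x i H.
Proof.
move=> dF dH; apply/matrixP => a b; rewrite dME 3!mxE -big_split /=.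
transitivity (pd i (fun y => \sum_k F y a k * H y k b) x).
  by apply: pd_eq => y; rewrite mxE.
rewrite pd_sum => [|k]; last exact: derivableM (dF a k) (dH k b).
by apply: eq_bigr => k _; rewrite !dME; exact: pdM (dF a k) (dH k b).
Qed.

Lemma derivable_mxT m p (F : 'rV[R]_n -> 'M[R]_(m, p)) :
  derivable_mx F -> derivable_mx (fun y => (F y)^T).
Proof.
by move=> dF a b; apply: derivable_eq (dF b a) => y; rewrite mxE.
Qed.

Lemma dMT m p (F : 'rV[R]_n -> 'M[R]_(m, p)) : dM x i (fun y => (F y)^T) = (dM x i F)^T.
Proof.
by apply/matrixP => a b; rewrite mxE !dME; apply: pd_eq => y; rewrite mxE.
Qed.

Lemma dM_near m p (F H : 'rV[R]_n -> 'M[R]_(m, p)) :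
  (\near x, F x = H x) -> dM x i F = dM x i H.
Proof.
move=> FH; apply/matrixP => a b; rewrite !dME !pdE; apply: near_eq_derive.
by apply: filterS FH => y ->.
Qed.

Lemma dM_cst m p (A : 'M[R]_(m, p)) : dM x i (fun=> A) = 0.
Proof. by apply/matrixP => a b; rewrite dME mxE pd_cst. Qed.
End Pointwise.

Section Smooth.
Context (U : set 'rV[R]_n) (oU : open U).

Definition smooth_mx m p (F : 'rV[R]_n -> 'M[R]_(m, p)) :=
  forall a b, smooth_on U (fun x => F x a b).

Lemma smooth_mx_derivable m p (F : 'rV[R]_n -> 'M[R]_(m, p)) i x :
  smooth_mx F -> U x -> derivable_mx x i F.
Proof. by move=> sF Ux a b; exact: smooth_derivable (sF a b) Ux. Qed.

Lemma smooth_mx_eq m p (F H : 'rV[R]_n -> 'M[R]_(m, p)) :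
  (forall x, U x -> F x = H x) -> smooth_mx F -> smooth_mx H.
Proof. by move=> FH sF a b; apply: smooth_eq (sF a b) => // x /FH ->. Qed.

Lemma smooth_mxD m p (F H : 'rV[R]_n -> 'M[R]_(m, p)) :
  smooth_mx F -> smooth_mx H -> smooth_mx (fun x => F x + H x).
Proof.
by move=> sF sH a b; apply: smooth_eq (smoothD oU (sF a b) (sH a b)) => // x _; rewrite mxE.
Qed.

Lemma smooth_mxN m p (F : 'rV[R]_n -> 'M[R]_(m, p)) :
  smooth_mx F -> smooth_mx (fun x => - F x).
Proof.
by move=> sF a b; apply: smooth_eq (smoothN oU (sF a b)) => // x _; rewrite mxE.
Qed.

Lemma smooth_mxZ m p f (F : 'rV[R]_n -> 'M[R]_(m, p)) :
  smooth_on U f -> smooth_mx F -> smooth_mx (fun x => f x *: F x).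
Proof.
by move=> sf sF a b; apply: smooth_eq (smoothM oU sf (sF a b)) => // x _; rewrite mxE.
Qed.

Lemma smooth_mxM m p q (F : 'rV[R]_n -> 'M[R]_(m, p)) (H : 'rV[R]_n -> 'M[R]_(p, q)) :
  smooth_mx F -> smooth_mx H -> smooth_mx (fun x => F x *m H x).
Proof.
move=> sF sH a b.
have sk k (_ : xpredT k) : smooth_on U (fun x => F x a k * H x k b).
  exact (smoothM oU (sF a k) (sH k b)).
have sS := @smooth_sum _ _ U oU _ (index_enum 'I_p) xpredT (fun k x => F x a k * H x k b) sk.
by apply: smooth_eq sS => // x _; rewrite mxE.
Qed.

Lemma smooth_mxT m p (F : 'rV[R]_n -> 'M[R]_(m, p)) :
  smooth_mx F -> smooth_mx (fun x => (F x)^T).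
Proof. by move=> sF a b; apply: smooth_eq (sF b a) => // x _; rewrite mxE. Qed.

Lemma smooth_dM m p (F : 'rV[R]_n -> 'M[R]_(m, p)) i :
  smooth_mx F -> smooth_mx (fun x => dM x i F).
Proof.
move=> sF a b; apply: smooth_eq (smooth_on_pderiv i (sF a b)) => // x _.
by rewrite dME pdE.
Qed.

Lemma dMC m p (F : 'rV[R]_n -> 'M[R]_(m, p)) i j x : smooth_mx F -> U x ->
  dM x i (fun y => dM y j F) = dM x j (fun y => dM y i F).
Proof.
move=> sF Ux; apply/matrixP => a b; rewrite !dME !pdE.
have E k : (fun y => dM y k F a b) = pderiv k (fun y => F y a b).
  by apply/funext => y; rewrite dME pdE.
by rewrite (E i) (E j); exact (smooth_pderivC oU i j (sF a b) Ux).
Qed.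

Lemma smooth_det m (F : 'rV[R]_n -> 'M[R]_m) :
  smooth_mx F -> smooth_on U (fun x => \det (F x)).
Proof.
move=> sF.
have sP (s : 'S_m) : smooth_on U (fun x => \prod_(a < m) F x a (s a)).
  exact (@smooth_prod R n U oU 'I_m (index_enum 'I_m) xpredT
    (fun a x => F x a (s a)) (fun a _ => sF a (s a))).
have sT (s : 'S_m) (_ : xpredT s) :
    smooth_on U (fun x => (-1) ^+ s * \prod_(a < m) F x a (s a)).
  exact (smoothM oU (smooth_cst ((-1) ^+ s)) (sP s)).
exact (@smooth_sum R n U oU _ (index_enum 'S_m) xpredT _ sT).
Qed.

(** By Cramer's rule the inverse is the adjugate over the determinant, both polynomial in the
    entries. *)
Lemma smooth_invmx m (F : 'rV[R]_n -> 'M[R]_m) :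
  (forall x, U x -> F x \in unitmx) -> smooth_mx F -> smooth_mx (fun x => invmx (F x)).
Proof.
move=> Fu sF; apply: (@smooth_mx_eq _ _ (fun x => (\det (F x))^-1 *: \adj (F x))).
  by move=> x Ux; rewrite /invmx Fu.
apply: smooth_mxZ.
  apply: smoothV => //; last exact: smooth_det.
  by move=> x /Fu; rewrite unitmxE unitfE.
move=> a b.
have : smooth_on U (fun x => cofactor (F x) b a).
  have sd : smooth_mx (fun x => row' b (col' a (F x))).
    move=> c d; apply: smooth_eq (sF (lift b c) (lift a d)) => // x _.
    by rewrite !mxE.
  rewrite /cofactor; exact (smoothM oU (smooth_cst _) (smooth_det sd)).
by apply: smooth_eq => // x _; rewrite mxE.
Qed.

Lemma smooth_pd f i : smooth_on U f -> smooth_on U (pd i f).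
Proof.
move=> sf; apply: smooth_eq (smooth_on_pderiv i sf) => // x _; exact: esym (pdE _ _ _).
Qed.

Lemma pdC f x i j : smooth_on U f -> U x -> pd i (pd j f) x = pd j (pd i f) x.
Proof.
move=> sf Ux; rewrite !pdE.
have E k : pd k f = pderiv k f by apply/funext => y; rewrite pdE.
by rewrite !E; exact (smooth_pderivC oU i j sf Ux).
Qed.

Lemma pd_on f g i x : (forall y, U y -> f y = g y) -> U x -> pd i f x = pd i g x.
Proof. by move=> fg Ux; rewrite !pdE; exact (pderiv_on oU i fg Ux). Qed.

Lemma dM_on m p (F H : 'rV[R]_n -> 'M[R]_(m, p)) i x :
  (forall y, U y -> F y = H y) -> U x -> dM x i F = dM x i H.
Proof.
move=> FH Ux; apply: dM_near.
by apply: filterS (open_nbhs_nbhs (conj oU Ux)) => y /FH.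
Qed.
End Smooth.
End MatrixCalculus.

(** * Positive definite matrices *)

Section PositiveDefinite.
Context {R : realType}.

Definition posdef n (G : 'M[R]_n) := forall v : 'rV[R]_n, v != 0 -> 0 < bilin G v v.

Lemma bilin_congr n (L G : 'M[R]_n) v w : bilin (L *m G *m L^T) v w = bilin G (v *m L) (w *m L).
Proof. by rewrite /bilin trmx_mul !mulmxA. Qed.

Lemma posdef_congr n (L G : 'M[R]_n) : L \in unitmx -> posdef G -> posdef (L *m G *m L^T).
Proof.
move=> Lu pG v v0; rewrite bilin_congr; apply: pG.
by apply: contra v0 => /eqP vL; rewrite -(mulmxK Lu v) vL mul0mx.
Qed.

(** Induction on the dimension: a congruence by [L] clears the first row and column beside the pivot
    [a]. The rows of [Q] form an orthonormal basis for [G]. *)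
Lemma posdef_orthonormal n (G : 'M[R]_n) : G^T = G -> posdef G ->
  exists Q : 'M[R]_n, Q *m G *m Q^T = 1%:M.
Proof.
elim: n G => [|n IH] G Gs pG; first by exists 0; apply/matrixP => -[].
rewrite -[n.+1]/(1 + n)%N in G Gs pG *.
set a := G 0 0; set c := dlsubmx G.
have a0 : 0 < a.
  have := pG (delta_mx 0 0); rewrite /bilin -rowE trmx_delta -colE !mxE; apply.
  by apply/eqP => /matrixP/(_ 0 0)/eqP; rewrite !mxE !eqxx oner_eq0.
have ulE : ulsubmx G = a%:M.
  by rewrite [LHS]mx11_scalar !mxE; congr (G _ _)%:M; apply/val_inj.
have urE : ursubmx G = c^T by rewrite /c trmx_dlsub Gs.
pose L : 'M[R]_(1 + n) := block_mx 1%:M 0 (- a^-1 *: c) 1%:M.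
have Lu : L \in unitmx by rewrite unitmxE det_lblock !det1 mul1r unitr1.
(* The Schur complement of the pivot; it inherits symmetry and positivity. *)
pose S := drsubmx G - a^-1 *: (c *m c^T).
have LG : L *m G *m L^T = block_mx a%:M 0 0 S.
  rewrite -[in LHS](submxK G) ulE urE -/c /L tr_block_mx !mulmx_block.
  rewrite !trmx1 trmx0 linearZ /= !mul0mx !mulmx0 !mul1mx !mulmx1 !addr0.
  rewrite mul_mx_scalar scalerA mulrN divff ?gt_eqF // scaleN1r addNr mul0mx add0r.
  rewrite mul_scalar_mx scalerA mulrN divff ?gt_eqF // scaleN1r addNr.
  by rewrite -scalemxAl scaleNr addrC.
have pB := posdef_congr Lu pG; rewrite LG in pB.
have Ss : S^T = S.
  by rewrite /S linearB linearZ /= trmx_mul trmxK trmx_drsub Gs.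
have [w w0|Q' Q'S] := IH S Ss.
  have := pB (row_mx 0 w); rewrite /bilin tr_row_mx mul_row_block !mul0mx !mulmx0 !add0r.
  rewrite mul_row_col mul0mx add0r; apply.
  by apply: contra w0 => /eqP E; rewrite -(row_mxKr (0 : 'rV[R]_1) w) E linear0.
(* The first basis vector has squared length [a] and is normalised. *)
pose s := (Num.sqrt a)^-1.
exists (block_mx s%:M 0 0 Q' *m L).
set D := block_mx _ _ _ _.
have -> : D *m L *m G *m (D *m L)^T = D *m (L *m G *m L^T) *m D^T by rewrite trmx_mul !mulmxA.
rewrite LG /D tr_block_mx !trmx0.
rewrite !mulmx_block !mul0mx !mulmx0 !addr0 !add0r Q'S tr_scalar_mx.
have -> : s%:M *m a%:M *m s%:M = 1%:M :> 'M[R]_1.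
  by rewrite -!scalar_mxM mulrAC -expr2 exprVn sqr_sqrtr ?ltW // mulVf ?gt_eqF.
by rewrite !mul0mx -scalar_mx_block.
Qed.

Lemma bilin_row n (Q B : 'M[R]_n) k : (Q *m B *m Q^T) k k = bilin B (row k Q) (row k Q).
Proof.
rewrite /bilin tr_row -row_mul [LHS]mxE [RHS]mxE; apply: eq_bigr => j _.
by rewrite [row _ _ _ _]mxE [col _ _ _ _]mxE.
Qed.

Section Consequences.
Context (n : nat) (G : 'M[R]_n) (Gs : G^T = G) (pG : posdef G).

Lemma posdef_unit : G \in unitmx.
Proof.
have [Q QG] := posdef_orthonormal Gs pG.
have : Q *m G *m Q^T \in unitmx by rewrite QG unitmx1.
by rewrite !unitmx_mul => /andP[/andP[]].
Qed.

(** This factor turns every trace with respect to [G] into a sum over the orthonormal rows of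
    [Q]. *)
Lemma posdef_inv_factor : exists2 Q : 'M[R]_n, Q \in unitmx & invmx G = Q^T *m Q.
Proof.
have [Q QG] := posdef_orthonormal Gs pG; have Gu := posdef_unit.
have Qu : Q \in unitmx.
  have : Q *m G *m Q^T \in unitmx by rewrite QG unitmx1.
  by rewrite !unitmx_mul => /andP[/andP[]].
exists Q => //.
have QTQG : Q^T *m Q *m G = 1%:M.
  by rewrite -mulmxA; apply: mulmx1C.
by rewrite -[RHS](mulmxK Gu) QTQG mul1mx.
Qed.

Lemma invmx_sym : (invmx G)^T = invmx G.
Proof. by rewrite trmx_inv Gs. Qed.

Lemma posdef_inv : posdef (invmx G).
Proof.
move=> v v0; have -> : bilin (invmx G) v v = bilin G (v *m invmx G) (v *m invmx G).
  by rewrite /bilin trmx_mul invmx_sym -!mulmxA mulKVmx ?posdef_unit.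
apply: pG; apply: contra v0 => /eqP E.
by rewrite -[v](mulmxKV posdef_unit) E mul0mx.
Qed.

Lemma trace_mx_psd (B : 'M[R]_n) :
  (forall v, 0 <= bilin B v v) -> 0 <= trace_mx G B.
Proof.
move=> pB; rewrite /trace_mx; have [Q _ ->] := posdef_inv_factor.
rewrite -mulmxA mxtrace_mulC; by apply: sumr_ge0 => k _; rewrite bilin_row.
Qed.

(** If [w = v *m B] were nonzero, moving from [v] along a small negative multiple of [w] would make
    the form negative, the linear term being twice the positive number [b]. *)
Lemma psd_isotropic (B : 'M[R]_n) (v : 'rV[R]_n) : B^T = B ->
  (forall w, 0 <= bilin B w w) -> bilin B v v = 0 -> v *m B = 0.
Proof.
move=> Bs pB v0; have [w Ew] : exists w, w = v *m B by exists (v *m B).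
rewrite -Ew; apply/eqP; apply: contraT => w0.
pose b := bilin B v w; pose c := bilin B w w.
have b0 : 0 < b.
  have -> : b = \sum_k w 0 k ^+ 2.
    by rewrite /b /bilin -Ew mxE; apply: eq_bigr => k _; rewrite [w^T _ _]mxE expr2.
  rewrite lt_def sumr_ge0 => [|k _]; last exact: sqr_ge0.
  rewrite andbT psumr_eq0 => [|k _]; last exact: sqr_ge0.
  apply: contra w0 => /allP H; apply/eqP/rowP => k; rewrite mxE.
  by have := H k (mem_index_enum k); rewrite /= sqrf_eq0 => /eqP.
have H t : 0 <= t * (2 * b) + t ^+ 2 * c.
  have bs : bilin B w v = b.
    have E : (v *m B *m w^T)^T = w *m B *m v^T by rewrite !trmx_mul trmxK Bs mulmxA.
    by rewrite /b /bilin -E mxE.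
  have E : bilin B (v + t *: w) (v + t *: w) =
      bilin B v v + t * bilin B v w + (t * bilin B w v + t * (t * bilin B w w)).
    rewrite /bilin linearD linearZ /= !mulmxDl !mulmxDr -!scalemxAl -!scalemxAr.
    by rewrite !mxE.
  have := pB (v + t *: w); rewrite E v0 bs -/b -/c.
  by congr (_ <= _); ring.
have c0 : 0 <= c by exact: pB.
(* The quadratic is least at [- b / c]; the [+ 1] keeps the denominator nonzero if [c = 0], and the
   value is still negative. *)
have := H (- b / (c + 1)); rewrite leNgt => /negP[].
have c1 : 0 < c + 1 by rewrite ltr_wpDl.
have -> : - b / (c + 1) * (2 * b) + (- b / (c + 1)) ^+ 2 * c = - (b ^+ 2 * (c + 2)) / (c + 1) ^+ 2.
  by field; rewrite gt_eqF.
by rewrite mulNr oppr_lt0 divr_gt0 ?exprn_gt0 // mulr_gt0 ?exprn_gt0 // ltr_wpDl.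
Qed.

(** The trace is a sum of nonnegative values of [B] on the rows of [Q]; all of them vanish, so each
    row is isotropic and is killed by [B]. *)
Lemma trace_mx_psd_eq0 (B : 'M[R]_n) : B^T = B ->
  (forall v, 0 <= bilin B v v) -> trace_mx G B = 0 -> B = 0.
Proof.
move=> Bs pB; rewrite /trace_mx; have [Q Qu ->] := posdef_inv_factor.
rewrite -mulmxA mxtrace_mulC.
rewrite /mxtrace (eq_bigr _ (fun k _ => bilin_row Q B k)) => /eqP.
rewrite psumr_eq0 => [/allP H|k _]; last exact: pB.
suff QB : Q *m B = 0 by rewrite -[B](mulKmx Qu) QB mulmx0.
apply/row_matrixP => k; rewrite row_mul row0; apply: psd_isotropic => //.
by apply/eqP/H; rewrite mem_index_enum.
Qed.

(** The left side is the squared norm of the form [B] with respect to [G], here computed in an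
    orthonormal basis. *)
Lemma trace_sq_factor (Q B : 'M[R]_n) : B^T = B -> invmx G = Q^T *m Q ->
  \tr (invmx G *m B *m (invmx G *m B)) = \sum_a \sum_b (Q *m B *m Q^T) a b ^+ 2.
Proof.
move=> Bs ->.
transitivity (\tr ((Q *m B *m Q^T) *m (Q *m B *m Q^T)^T)).
  by rewrite !trmx_mul trmxK Bs -!mulmxA mxtrace_mulC -!mulmxA.
rewrite /mxtrace; apply: eq_bigr => a _; rewrite mxE; apply: eq_bigr => b _.
by rewrite [X in _ * X]mxE expr2.
Qed.

Lemma trace_sq_ge0 (B : 'M[R]_n) : B^T = B ->
  0 <= \tr (invmx G *m B *m (invmx G *m B)).
Proof.
move=> Bs; have [Q Qu E] := posdef_inv_factor; rewrite (trace_sq_factor Bs E).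
by apply: sumr_ge0 => a _; apply: sumr_ge0 => b _; exact: sqr_ge0.
Qed.

Lemma trace_sq_eq0 (B : 'M[R]_n) : B^T = B ->
  \tr (invmx G *m B *m (invmx G *m B)) = 0 -> B = 0.
Proof.
move=> Bs; have [Q Qu E] := posdef_inv_factor; rewrite (trace_sq_factor Bs E) => /eqP.
rewrite psumr_eq0 => [/allP H|a _]; last by apply: sumr_ge0 => b _; exact: sqr_ge0.
have QBQ : Q *m B *m Q^T = 0.
  apply/matrixP => a b; have /implyP/(_ isT) := H a (mem_index_enum a).
  rewrite psumr_eq0 => [/allP H'|c _]; last exact: sqr_ge0.
  have /implyP/(_ isT) := H' b (mem_index_enum b).
  by rewrite sqrf_eq0 [RHS]mxE => /eqP.
rewrite -[B](mulKmx Qu) -[Q *m B](@mulmxK _ _ _ Q^T) ?unitmx_tr //.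
by rewrite QBQ mul0mx mulmx0.
Qed.
End Consequences.
End PositiveDefinite.

(** * Connection and curvature of a metric on an open set *)

Section MatrixIdentities.
Context {R : comPzRingType} {n : nat}.
Implicit Types (X Y Z : 'M[R]_n).

Lemma mxDE m p (X Y : 'M[R]_(m, p)) a b : (X + Y) a b = X a b + Y a b.
Proof. exact: mxE. Qed.

Lemma mxNE m p (X : 'M[R]_(m, p)) a b : (- X) a b = - X a b.
Proof. exact: mxE. Qed.

Lemma trmxD m p (X Y : 'M[R]_(m, p)) : (X + Y)^T = X^T + Y^T.
Proof. exact: raddfD. Qed.

Lemma trmxN m p (X : 'M[R]_(m, p)) : (- X)^T = - X^T.
Proof. exact: raddfN. Qed.

Lemma mx_addBB m p (X Y Z W : 'M[R]_(m, p)) a b :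
  (X - Y + (Z - W)) a b = X a b + Z a b - (Y a b + W a b).
Proof. by rewrite !(mxDE, mxNE) opprD addrACA. Qed.

Definition mx_lin_simp := (mulmxDl, mulmxDr, mulmxN, mulNmx, mulmxA, @mxDE, @mxNE).

(* [dij] plays the part of the derivative of [Aj] in the direction [i], and the
   hypothesis that of the symmetry of the second derivatives of [G]. *)
Lemma curvature_skew_alg (G Ai Aj dij dji : 'M[R]_n) :
  dij^T *m G + Aj^T *m (Ai^T *m G + G *m Ai)
  + ((Ai^T *m G + G *m Ai) *m Aj + G *m dij) =
  dji^T *m G + Ai^T *m (Aj^T *m G + G *m Aj)
  + ((Aj^T *m G + G *m Aj) *m Ai + G *m dji) ->
  (dij - dji + (Ai *m Aj - Aj *m Ai))^T *m G
  + G *m (dij - dji + (Ai *m Aj - Aj *m Ai)) = 0.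
Proof.
move=> /eqP; rewrite -subr_eq0 => /eqP E; rewrite -[RHS]E.
rewrite !(trmxD, trmxN, trmx_mul).
apply/matrixP => a b; rewrite !mx_lin_simp.
ring.
Qed.

(** [dij] stands for the derivative of [Aj] in direction [i], and [p], [q], [r] for the second
    derivatives d_1 d_2 A_3, d_1 d_3 A_2, d_2 d_3 A_1, which cancel in pairs. The rest is the
    Leibniz rule and the Jacobi identity. *)
Lemma second_bianchi_alg (A1 A2 A3 d12 d13 d21 d23 d31 d32 p q r : 'M[R]_n)
  (R12 := d12 - d21 + (A1 *m A2 - A2 *m A1))
  (R23 := d23 - d32 + (A2 *m A3 - A3 *m A2))
  (R31 := d31 - d13 + (A3 *m A1 - A1 *m A3)) :
  (p - q) + (d12 *m A3 + A2 *m d13 - (d13 *m A2 + A3 *m d12))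
   + (A1 *m R23 - R23 *m A1)
  + ((r - p) + (d23 *m A1 + A3 *m d21 - (d21 *m A3 + A1 *m d23))
   + (A2 *m R31 - R31 *m A2))
  + ((q - r) + (d31 *m A2 + A1 *m d32 - (d32 *m A1 + A2 *m d31))
   + (A3 *m R12 - R12 *m A3)) = 0.
Proof.
rewrite /R12 /R23 /R31; apply/matrixP => a b; rewrite !mx_lin_simp [RHS]mxE.
ring.
Qed.

(** With [B] the transpose of [A], the bracket is minus the derivative of the inverse metric [Gi].
    Its parallelism absorbs the connection term of the raised index and leaves a commutator. *)
Lemma covariant_raise_alg (dR X A B Gi : 'M[R]_n) :
  dR *m Gi + X *m - (A *m Gi + Gi *m B) + A *m (X *m Gi) + X *m Gi *m B =
  (dR + (A *m X - X *m A)) *m Gi.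
Proof. by apply/matrixP => a b; rewrite !(opprD, mx_lin_simp); ring. Qed.
End MatrixIdentities.

HB.lock Definition conn {R : realType} {n : nat} (G : 'rV[R]_n -> 'M[R]_n) (i : 'I_n)
  (x : 'rV[R]_n) : 'M[R]_n := \matrix_(l, k) christoffel G l i k x.

HB.lock Definition curv {R : realType} {n : nat} (G : 'rV[R]_n -> 'M[R]_n) (i j : 'I_n)
  (x : 'rV[R]_n) : 'M[R]_n :=
  dM x i (conn G j) - dM x j (conn G i) + (conn G i x *m conn G j x - conn G j x *m conn G i x).

(** Raising the lower matrix index makes this matrix literally antisymmetric, and contractions then
    involve no metric to be differentiated. *)
HB.lock Definition curv_up {R : realType} {n : nat} (G : 'rV[R]_n -> 'M[R]_n) (i j : 'I_n)
  (x : 'rV[R]_n) : 'M[R]_n := curv G i j x *m invmx (G x).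

(** The direction indices [b] and [c] receive no connection term: by torsion-freeness such terms
    would drop out of the cyclic sum in the second Bianchi identity. *)
HB.lock Definition dcurv_up {R : realType} {n : nat} (G : 'rV[R]_n -> 'M[R]_n) (a b c : 'I_n)
  (x : 'rV[R]_n) : 'M[R]_n :=
  dM x a (curv_up G b c) + conn G a x *m curv_up G b c x + curv_up G b c x *m (conn G a x)^T.

Record metric_on {R : realType} {n : nat} (U : set 'rV[R]_n) (G : 'rV[R]_n -> 'M[R]_n) : Prop :=
  MetricOn {
  metric_on_open : open U;
  metric_on_smooth : smooth_mx U G;
  metric_on_sym : forall x, U x -> (G x)^T = G x;
  metric_on_posdef : forall x, U x -> posdef (G x) }.

Section LocalGeometry.
Context {R : realType} {n : nat} {U : set 'rV[R]_n} {G : 'rV[R]_n -> 'M[R]_n}.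
Context (HG : metric_on U G).
Local Notation oU := (metric_on_open HG).
Local Notation sG := (metric_on_smooth HG).
Local Notation Gsym := (metric_on_sym HG).
Local Notation Gpos := (metric_on_posdef HG).
Implicit Types (x y : 'rV[R]_n) (i j k l a b c : 'I_n) (u v : 'rV[R]_n -> R).
Implicit Types (V W : 'rV[R]_n -> 'cV[R]_n).

Local Notation A := (conn G).
Local Notation Rm := (curv G).
Local Notation RG := (curv_up G).
Local Notation DRG := (dcurv_up G).

Lemma connE i x l k : A i x l k = christoffel G l i k x.
Proof. by rewrite unlock mxE. Qed.

Lemma curv_def i j : Rm i j =
  fun x => dM x i (A j) - dM x j (A i) + (A i x *m A j x - A j x *m A i x).
Proof. by apply/funext => x; rewrite curv.unlock. Qed.

Lemma near_on (P : 'rV[R]_n -> Prop) x : (forall y, U y -> P y) -> U x -> \forall y \near x, P y.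
Proof. by move=> HP Ux; apply: filterS (open_nbhs_nbhs (conj oU Ux)) => y /HP. Qed.

Lemma metric_unit x : U x -> G x \in unitmx.
Proof. by move=> Ux; apply: posdef_unit; [exact: Gsym|exact: Gpos]. Qed.

Lemma smooth_metric_inv : smooth_mx U (fun x => invmx (G x)).
Proof. exact (smooth_invmx oU metric_unit sG). Qed.

Lemma smooth_conn i : smooth_mx U (A i).
Proof.
move=> l k; rewrite (_ : (fun x => _) = christoffel G l i k); last first.
  by apply/funext => x; rewrite connE.
have T m (_ : xpredT m) : smooth_on U (fun x => invmx (G x) l m *
    (pderiv i (fun y => G y k m) x + pderiv k (fun y => G y i m) x
     - pderiv m (fun y => G y i k) x)).
  exact (smoothM oU (smooth_metric_inv l m)
    (smoothB oU (smoothD oU (smooth_on_pderiv i (sG k m)) (smooth_on_pderiv k (sG i m)))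
       (smooth_on_pderiv m (sG i k)))).
exact (smoothM oU (smooth_cst _)
  (@smooth_sum R n U oU _ (index_enum 'I_n) xpredT _ T)).
Qed.

Lemma conn_sym i j l x : U x -> A i x l j = A j x l i.
Proof.
by move=> Ux; rewrite !connE; apply: christoffel_torsion_free; exact: near_on Gsym Ux.
Qed.

Lemma dM_metric k x : U x -> dM x k G = (A k x)^T *m G x + G x *m A k x.
Proof.
move=> Ux; apply/matrixP => i j; rewrite dME pdE.
rewrite (christoffel_metric _ _ _ (near_on Gsym Ux) (metric_unit Ux)).
rewrite big_split /= mxDE [X in _ = X + _]mxE [X in _ = _ + X]mxE.
by congr (_ + _); apply: eq_bigr => l _; rewrite -connE ?[_^T _ _]mxE // mulrC.
Qed.

Lemma dM_metric_inv k x : U x -> dM x k (fun y => invmx (G y)) =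
  - (A k x *m invmx (G x) + invmx (G x) *m (A k x)^T).
Proof.
move=> Ux; have Gu := metric_unit Ux.
have dGi : derivable_mx x k (fun y => invmx (G y)) := smooth_mx_derivable smooth_metric_inv Ux.
have dG : derivable_mx x k G := smooth_mx_derivable sG Ux.
have : dM x k (fun y => invmx (G y) *m G y) = 0.
  rewrite (dM_on (H := fun=> 1%:M) oU) ?dM_cst // => y Uy.
  by rewrite mulVmx ?metric_unit.
rewrite (dMM dGi dG) dM_metric // => /eqP; rewrite addr_eq0 => /eqP E.
rewrite -[LHS](mulmxK Gu) E mulNmx mulmxDr mulmxDl addrC !mulmxA mulVmx // mul1mx.
by rewrite -!mulmxA mulmxV // mulmx1.
Qed.

Lemma smooth_curv i j : smooth_mx U (Rm i j).
Proof.
have sd a b := smooth_dM oU a (smooth_conn b).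
have sm a b := smooth_mxM oU (smooth_conn a) (smooth_conn b).
rewrite curv_def; exact (smooth_mxD oU (smooth_mxD oU (sd i j) (smooth_mxN oU (sd j i)))
  (smooth_mxD oU (sm i j) (smooth_mxN oU (sm j i)))).
Qed.

Lemma curvE i j k l x : riemann G l i j k x = Rm i j x l k.
Proof.
have E a b : pderiv a (christoffel G l b k) x = dM x a (A b) l k.
  by rewrite dME -pdE; apply: pd_eq => y; rewrite connE.
have M a b : (A a x *m A b x) l k =
    \sum_(m < n) christoffel G l a m x * christoffel G m b k x.
  by rewrite mxE; apply: eq_bigr => m _; rewrite !connE.
rewrite /riemann curv_def 2!mxDE mxNE mxDE mxNE.
apply: (congr2 +%R); last by rewrite sumrB (M i j) (M j i).
exact: congr2 (E i j) (congr1 -%R (E j i)).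
Qed.

Lemma curvC i j x : Rm j i x = - Rm i j x.
Proof. by rewrite !curv_def opprD !opprB. Qed.

(** Differentiating [dM_metric] once more and equating the two mixed second derivatives of [G]
    leaves exactly this. *)
Lemma curv_skew i j x : U x -> (Rm i j x)^T *m G x + G x *m Rm i j x = 0.
Proof.
move=> Ux.
have dA k l : derivable_mx x l (A k) := smooth_mx_derivable (smooth_conn k) Ux.
have dG l : derivable_mx x l G := smooth_mx_derivable sG Ux.
have E k l : dM x k (fun y => dM y l G) = (dM x k (A l))^T *m G x
    + (A l x)^T *m ((A k x)^T *m G x + G x *m A k x)
    + (((A k x)^T *m G x + G x *m A k x) *m A l x + G x *m dM x k (A l)).
  rewrite (dM_on oU k (fun y => @dM_metric l y) Ux).
  have dT := derivable_mxT (dA l k).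
  rewrite (dMD (derivable_mxM dT (dG k)) (derivable_mxM (dG k) (dA l k))).
  by rewrite (dMM dT (dG k)) (dMM (dG k) (dA l k)) dMT dM_metric.
have D := dMC oU i j sG Ux; rewrite (E i j) (E j i) in D.
by rewrite curv_def; exact (curvature_skew_alg D).
Qed.

Lemma curv_upE i j : RG i j = fun x => Rm i j x *m invmx (G x).
Proof. by apply/funext => x; rewrite curv_up.unlock. Qed.

Lemma smooth_curv_up i j : smooth_mx U (RG i j).
Proof. rewrite curv_upE; exact (smooth_mxM oU (smooth_curv i j) smooth_metric_inv). Qed.

Lemma curv_upC i j x : RG j i x = - RG i j x.
Proof. by rewrite !curv_upE curvC mulNmx. Qed.

Lemma curv_up_skew i j x : U x -> (RG i j x)^T = - RG i j x.
Proof.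
move=> Ux; have Gu := metric_unit Ux; have E := curv_skew i j Ux.
move/eqP: E; rewrite addr_eq0 => /eqP E.
rewrite curv_upE trmx_mul invmx_sym ?Gsym // -[_^T in LHS](mulmxK Gu) E.
by rewrite mulNmx mulmxN !mulmxA mulVmx // mul1mx.
Qed.

Lemma curv_up_skewE i j x k l : U x -> RG i j x l k = - RG i j x k l.
Proof.
move=> Ux; have /matrixP/(_ k l) := curv_up_skew i j Ux.
by rewrite mxE mxNE.
Qed.

(** The curvature is minus its own adjoint with respect to [G], and a matrix has the same trace as
    its adjoint. *)
Lemma trace_curv i j x : U x -> \tr (Rm i j x) = 0.
Proof.
move=> Ux; have Gu := metric_unit Ux.
have E : \tr (Rm i j x) = - \tr (Rm i j x).
  rewrite -[in RHS]mxtrace_tr -[in RHS](mulmxK Gu (Rm i j x)^T).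
  have /eqP := curv_skew i j Ux; rewrite addr_eq0 => /eqP ->.
  by rewrite mulNmx linearN opprK /= mxtrace_mulC mulmxA mulVmx // mul1mx.
by move: (\tr _) E => t; lra.
Qed.

Lemma first_bianchi i j k l x : U x ->
  Rm i j x l k + Rm j k x l i + Rm k i x l j = 0.
Proof.
move=> Ux.
have dS a b c : dM x a (A b) l c = dM x a (A c) l b.
  rewrite !dME.
  by apply: (pd_on oU a _ Ux) => y Uy; exact: conn_sym.
have mS a b c : (A a x *m A b x) l c = (A a x *m A c x) l b.
  rewrite [LHS]mxE [RHS]mxE; apply: eq_bigr => m _; congr (_ * _).
  exact: conn_sym.
(* Curvature is [T] antisymmetrised in its first two arguments, while torsion-freeness makes [T]
   symmetric in the last two; the cyclic sum cancels. *)
pose T a b c := dM x a (A b) l c + (A a x *m A b x) l c.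
have TS a b c : T a b c = T a c b by rewrite /T dS mS.
have CT a b c : Rm a b x l c = T a b c - T b a c by rewrite curv_def mx_addBB.
rewrite !CT (TS i j k) (TS j k i) (TS k i j).
move: (T i k j) (T j i k) (T k j i) => p q r; ring.
Qed.

Lemma ricciE j k x : ricci_mx G x j k = \sum_i Rm i j x i k.
Proof. by rewrite mxE; apply: eq_bigr => i _; exact: curvE. Qed.

(** The first Bianchi identity turns the antisymmetric part into a trace of [Rm j k], which is
    zero. *)
Lemma ricci_sym x : U x -> (ricci_mx G x)^T = ricci_mx G x.
Proof.
move=> Ux; apply/matrixP => k j; rewrite [LHS]mxE !ricciE.
apply/eqP; rewrite -subr_eq0 -sumrB.
rewrite (eq_bigr (fun i => - Rm j k x i i)) => [|i _].
  by rewrite sumrN; have := trace_curv j k Ux; rewrite /mxtrace => ->; rewrite oppr0.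
have := first_bianchi i j k i Ux; rewrite (curvC i k) mxNE => /eqP.
by rewrite addrAC addr_eq0 => /eqP ->.
Qed.

(** Raising an index commutes with covariant differentiation, so the Bianchi identity can be proved
    for the unraised curvature. *)
Lemma dcurv_upE a b c x : U x -> DRG a b c x =
  (dM x a (Rm b c) + (A a x *m Rm b c x - Rm b c x *m A a x)) *m invmx (G x).
Proof.
move=> Ux; have dR : derivable_mx x a (Rm b c) := smooth_mx_derivable (smooth_curv b c) Ux.
have dGi : derivable_mx x a (fun y => invmx (G y)) := smooth_mx_derivable smooth_metric_inv Ux.
rewrite dcurv_up.unlock curv_upE (dMM dR dGi) dM_metric_inv //.
exact: covariant_raise_alg.
Qed.

Lemma second_bianchi a b c x : U x ->
  DRG a b c x + DRG b c a x + DRG c a b x = 0.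
Proof.
move=> Ux.
have dA k l : derivable_mx x l (A k) := smooth_mx_derivable (smooth_conn k) Ux.
have ddA k l m : derivable_mx x l (fun y => dM y m (A k)) :=
  smooth_mx_derivable (smooth_dM oU m (smooth_conn k)) Ux.
have E i j k : dM x i (Rm j k) =
    (dM x i (fun y => dM y j (A k)) - dM x i (fun y => dM y k (A j)))
    + (dM x i (A j) *m A k x + A j x *m dM x i (A k)
       - (dM x i (A k) *m A j x + A k x *m dM x i (A j))).
  rewrite curv_def (dMD (derivable_mxD (ddA k i j) (derivable_mxN (ddA j i k)))
    (derivable_mxD (derivable_mxM (dA j i) (dA k i))
       (derivable_mxN (derivable_mxM (dA k i) (dA j i))))).
  rewrite (dMD (ddA k i j) (derivable_mxN (ddA j i k))) (dMN (ddA j i k)).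
  rewrite (dMD (derivable_mxM (dA j i) (dA k i))
       (derivable_mxN (derivable_mxM (dA k i) (dA j i)))).
  rewrite (dMN (derivable_mxM (dA k i) (dA j i))).
  by rewrite (dMM (dA j i) (dA k i)) (dMM (dA k i) (dA j i)).
rewrite !dcurv_upE // -!mulmxDl.
rewrite (E a b c) (E b c a) (E c a b).
rewrite (dMC oU b a (smooth_conn c) Ux) (dMC oU c a (smooth_conn b) Ux) (dMC oU c b (smooth_conn a) Ux).
rewrite !curv_def second_bianchi_alg mul0mx.
by [].
Qed.
End LocalGeometry.

(** * Gradient, divergence and the Bochner formula *)

HB.lock Definition dcol {R : realType} {n : nat} (u : 'rV[R]_n -> R) (x : 'rV[R]_n) : 'cV[R]_n :=
  \col_i pd i u x.

HB.lock Definition grad {R : realType} {n : nat} (G : 'rV[R]_n -> 'M[R]_n) (u : 'rV[R]_n -> R)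
  (x : 'rV[R]_n) : 'cV[R]_n := invmx (G x) *m dcol u x.

HB.lock Definition cov {R : realType} {n : nat} (G : 'rV[R]_n -> 'M[R]_n)
  (V : 'rV[R]_n -> 'cV[R]_n) (a : 'I_n) (x : 'rV[R]_n) : 'cV[R]_n :=
  dM x a V + conn G a x *m V x.

(** Column [a] is the derivative along d_a, so the matrix acts on tangent columns: its trace is the
    divergence of [V], and its product with [W] is the derivative of [V] along [W]. *)
HB.lock Definition nabla {R : realType} {n : nat} (G : 'rV[R]_n -> 'M[R]_n)
  (V : 'rV[R]_n -> 'cV[R]_n) (x : 'rV[R]_n) : 'M[R]_n := \matrix_(l, a) cov G V a x l 0.

HB.lock Definition ric {R : realType} {n : nat} (G : 'rV[R]_n -> 'M[R]_n) (x : 'rV[R]_n) :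
  'M[R]_n := ricci_mx G x.

HB.lock Definition hess {R : realType} {n : nat} (G : 'rV[R]_n -> 'M[R]_n) (u : 'rV[R]_n -> R)
  (x : 'rV[R]_n) : 'M[R]_n := hessian_mx G u x.

HB.lock Definition lap {R : realType} {n : nat} (G : 'rV[R]_n -> 'M[R]_n) (u : 'rV[R]_n -> R)
  (x : 'rV[R]_n) : R := trace_mx (G x) (hess G u x).

HB.lock Definition grad2 {R : realType} {n : nat} (G : 'rV[R]_n -> 'M[R]_n) (u : 'rV[R]_n -> R)
  (x : 'rV[R]_n) : R := ((dcol u x)^T *m grad G u x) 0 0.

Lemma mulmx_colE (R : pzSemiRingType) m p q (X : 'M[R]_(m, p)) (Y : 'M[R]_(p, q)) a b c :
  (X *m col b Y) a c = (X *m Y) a b.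
Proof. by rewrite [LHS]mxE [RHS]mxE; apply: eq_bigr => k _; rewrite mxE. Qed.

Section Gradient.
Context {R : realType} {n : nat} {U : set 'rV[R]_n} {G : 'rV[R]_n -> 'M[R]_n}.
Context (HG : metric_on U G).
Local Notation oU := (metric_on_open HG).
Local Notation sG := (metric_on_smooth HG).
Local Notation Gsym := (metric_on_sym HG).
Local Notation A := (conn G).
Local Notation Rm := (curv G).
Implicit Types (x y : 'rV[R]_n) (i j k l a b c : 'I_n) (u v : 'rV[R]_n -> R).
Implicit Types (V W : 'rV[R]_n -> 'cV[R]_n).

Lemma dcolE u x i (j : 'I_1) : dcol u x i j = pd i u x.
Proof. by rewrite unlock mxE. Qed.

Lemma gradE u x : grad G u x = invmx (G x) *m dcol u x.
Proof. by rewrite unlock. Qed.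

Lemma covE V a x : cov G V a x = dM x a V + A a x *m V x.
Proof. by rewrite unlock. Qed.

Lemma nablaE V x l a : nabla G V x l a = cov G V a x l 0.
Proof. by rewrite unlock mxE. Qed.

Lemma trace_nabla V x : \tr (nabla G V x) = \sum_a cov G V a x a 0.
Proof. by rewrite /mxtrace; apply: eq_bigr => a _; rewrite nablaE. Qed.

Lemma smooth_dcol u : smooth_on U u -> smooth_mx U (dcol u).
Proof.
move=> su i j; apply: smooth_eq (smooth_pd oU i su) => [|x _]; first exact: oU.
by rewrite dcolE.
Qed.

Lemma smooth_grad u : smooth_on U u -> smooth_mx U (grad G u).
Proof.
move=> /smooth_dcol su; rewrite (_ : grad G u = fun x => invmx (G x) *m dcol u x).
  exact (smooth_mxM oU (smooth_metric_inv HG) su).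
by apply/funext => x; exact: gradE.
Qed.

Lemma smooth_cov V a : smooth_mx U V -> smooth_mx U (cov G V a).
Proof.
move=> sV; rewrite (_ : cov G V a = fun x => dM x a V + A a x *m V x).
  exact (smooth_mxD oU (smooth_dM oU a sV) (smooth_mxM oU (smooth_conn HG a) sV)).
by apply/funext => x; exact: covE.
Qed.

Lemma smooth_nabla V : smooth_mx U V -> smooth_mx U (nabla G V).
Proof.
move=> sV l a; apply: smooth_eq (smooth_cov a sV l 0) => [|x _]; first exact: oU.
by rewrite nablaE.
Qed.

Lemma smooth_trace m (F : 'rV[R]_n -> 'M[R]_m) : smooth_mx U F ->
  smooth_on U (fun x => \tr (F x)).
Proof.
move=> sF; exact (@smooth_sum R n U oU _ (index_enum 'I_m) xpredT (fun (a : 'I_m) x => F x a a) (fun (a : 'I_m) _ => sF a a)).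
Qed.

Lemma metric_grad u x : U x -> G x *m grad G u x = dcol u x.
Proof. by move=> Ux; rewrite gradE mulmxA mulmxV ?mul1mx ?(metric_unit HG). Qed.

Lemma hessE u x i j : hess G u x i j =
  pd i (pd j u) x - \sum_k A i x k j * pd k u x.
Proof.
rewrite hess.unlock mxE pdE (_ : pd j u = pderiv j u); last first.
  by apply/funext => y; exact: pdE.
congr (_ - _); apply: eq_bigr => k _; by rewrite connE pdE.
Qed.

Lemma hess_sym u x : smooth_on U u -> U x -> (hess G u x)^T = hess G u x.
Proof.
move=> su Ux; apply/matrixP => j i; rewrite mxE !hessE (pdC oU i j su Ux).
congr (_ - _); apply: eq_bigr => k _; by rewrite (conn_sym HG i j k Ux).
Qed.

Lemma dM_dcol u x a : smooth_on U u -> U x ->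
  dM x a (dcol u) = G x *m cov G (grad G u) a x + (A a x)^T *m dcol u x.
Proof.
move=> su Ux.
have dG : derivable_mx x a G := smooth_mx_derivable sG Ux.
have dV : derivable_mx x a (grad G u) := smooth_mx_derivable (smooth_grad su) Ux.
have := dM_on oU a (fun y Uy => @metric_grad u y Uy) Ux.
rewrite (dMM dG dV) (dM_metric HG) // => <-.
rewrite covE -(metric_grad u Ux) mulmxDr mulmxDl !mulmxA.
by rewrite [RHS]addrC [X in _ = _ + X]addrC addrA.
Qed.

Lemma hess_nabla u x : smooth_on U u -> U x ->
  hess G u x = G x *m nabla G (grad G u) x.
Proof.
move=> su Ux; rewrite -(hess_sym su Ux); apply/matrixP => j i.
rewrite mxE hessE [RHS]mxE.
have /matrixP/(_ j 0) := dM_dcol i su Ux.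
rewrite mxDE dME => /eqP; rewrite -subr_eq => /eqP.
rewrite [X in _ = X -> _]mxE (eq_bigr _ (fun l _ => congr1 _ (esym (nablaE _ _ _ _)))) => <-.
congr (_ - _); last first.
  by rewrite mxE; apply: eq_bigr => k _; rewrite dcolE mxE.
by apply: pd_eq => y; rewrite dcolE.
Qed.

Lemma lap_div u x : smooth_on U u -> U x -> lap G u x = \tr (nabla G (grad G u) x).
Proof.
move=> su Ux; rewrite lap.unlock /trace_mx (hess_nabla su Ux) mulmxA mulVmx ?mul1mx //.
exact (metric_unit HG Ux).
Qed.

Lemma smooth_lap u : smooth_on U u -> smooth_on U (lap G u).
Proof.
move=> su; apply: smooth_eq (smooth_trace (smooth_nabla (smooth_grad su))) => [|x Ux].
  exact: oU.
by rewrite lap_div.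
Qed.

(** [cov G V c] is differentiated as a vector field with [c] frozen. The omitted term is symmetric
    in [a] and [c], so it would cancel in the difference. *)
Lemma ricci_identity V a c x : smooth_mx U V -> U x ->
  dM x a (cov G V c) + A a x *m cov G V c x - (dM x c (cov G V a) + A c x *m cov G V a x)
  = Rm a c x *m V x.
Proof.
move=> sV Ux.
have dV b : derivable_mx x b V := smooth_mx_derivable sV Ux.
have ddV b d : derivable_mx x b (fun y => dM y d V) := smooth_mx_derivable (smooth_dM oU d sV) Ux.
have dA b d : derivable_mx x b (A d) := smooth_mx_derivable (smooth_conn HG d) Ux.
have E b d : dM x b (cov G V d) + A b x *m cov G V d x =
   dM x b (fun y => dM y d V) + (dM x b (A d) *m V x + A d x *m dM x b V)
   + A b x *m (dM x d V + A d x *m V x).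
  rewrite -[X in _ = _ + _ *m X]covE; congr (_ + _).
  rewrite (_ : cov G V d = fun y => dM y d V + A d y *m V y); last first.
    by apply/funext => y; exact: covE.
  by rewrite (dMD (ddV b d) (derivable_mxM (dA b d) (dV b))) (dMM (dA b d) (dV b)).
rewrite !E (dMC oU c a sV Ux) curv_def.
move: (dM x a (fun y => _)) (dM x a V) (dM x c V) (dM x a (A c)) (dM x c (A a)) (A a x) (A c x) (V x).
move=> h da dc dac dca Aa Ac v.
by apply/matrixP => p q; rewrite !(opprD, mx_lin_simp); ring.
Qed.

Lemma ric_sum x c V : U x -> \sum_a (Rm a c x *m V x) a 0 = (ric G x *m V x) c 0.
Proof.
move=> Ux; rewrite mxE.
under eq_bigr do rewrite mxE.
rewrite exchange_big; apply: eq_bigr => k _ /=.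
by rewrite -mulr_suml ric.unlock ricciE.
Qed.

(** The core of Bochner's formula, for an arbitrary field: div of nabla_V V. Commuting the two
    derivatives of [V] yields the derivative of div V and, through the traced Ricci identity, the
    Ricci term. *)
Lemma div_nabla V x : smooth_mx U V -> U x ->
  \tr (nabla G (fun y => nabla G V y *m V y) x) =
  \tr (nabla G V x *m nabla G V x)
  + \sum_c V x c 0 * pd c (fun y => \tr (nabla G V y)) x
  + ((V x)^T *m ric G x *m V x) 0 0.
Proof.
move=> sV Ux.
have sN := smooth_nabla sV.
have dV b : derivable_mx x b V := smooth_mx_derivable sV Ux.
have dN b : derivable_mx x b (nabla G V) := smooth_mx_derivable sN Ux.
set H := nabla G V x.
have dVE a : dM x a V = cov G V a x - A a x *m V x by rewrite covE addrK.
have colH a : col a H = cov G V a x.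
  by apply/colP => l; rewrite mxE nablaE.
have dNE a c : dM x a (nabla G V) a c = dM x a (cov G V c) a 0.
  by rewrite !dME; apply: pd_eq => y; rewrite nablaE.
have dtr c : pd c (fun y => \tr (nabla G V y)) x = \sum_a dM x c (cov G V a) a 0.
  rewrite (pd_sum (fun a => dN c a a)); apply: eq_bigr => a _.
  by rewrite dME; apply: pd_eq => y; rewrite nablaE.
have E a : cov G (fun y => nabla G V y *m V y) a x a 0 =
   \sum_c dM x a (cov G V c) a 0 * V x c 0
   + \sum_c H a c * (cov G V a x c 0 - (A a x *m V x) c 0)
   + (A a x *m (H *m V x)) a 0.
  rewrite covE (dMM (dN a) (dV a)) mxDE; congr (_ + _).
  rewrite mxDE [X in X + _ = _]mxE [X in _ + X = _]mxE; congr (_ + _).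
    by apply: eq_bigr => c _; rewrite dNE.
  by apply: eq_bigr => c _; rewrite dVE mxDE mxNE.
rewrite trace_nabla (eq_bigr _ (fun a _ => E a)) !big_split /=.
have RI a c : dM x a (cov G V c) a 0 = dM x c (cov G V a) a 0
    + (A c x *m cov G V a x) a 0 - (A a x *m cov G V c x) a 0 + (Rm a c x *m V x) a 0.
  rewrite -(ricci_identity a c sV Ux) !mxDE !mxNE !mxDE; ring.
(* [T1] and [T2] gather the terms that are not covariant: [F1] yields [T1 - T2], [F2] yields [- T1],
   and the last summand of [E] is [T2]. *)
pose T1 := \sum_c V x c 0 * \tr (A c x *m H).
pose T2 := \sum_a (A a x *m (H *m V x)) a 0.
have F1 : \sum_a \sum_c dM x a (cov G V c) a 0 * V x c 0 =
  \sum_c V x c 0 * pd c (fun y => \tr (nabla G V y)) x + T1 - T2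
  + ((V x)^T *m ric G x *m V x) 0 0.
  rewrite exchange_big /=.
  transitivity (\sum_c (V x c 0 * pd c (fun y => \tr (nabla G V y)) x
     + V x c 0 * \tr (A c x *m H) - \sum_a (A a x *m H) a c * V x c 0
     + V x c 0 * (ric G x *m V x) c 0)).
    apply: eq_bigr => c _; rewrite -(ric_sum c V Ux) dtr /mxtrace !mulr_sumr.
    rewrite -big_split -sumrB -big_split /=; apply: eq_bigr => a _.
    rewrite RI.
    have -> : (A c x *m cov G V a x) a 0 = (A c x *m H) a a.
      by rewrite -colH mulmx_colE.
    have -> : (A a x *m cov G V c x) a 0 = (A a x *m H) a c.
      by rewrite -colH mulmx_colE.
    ring.
  rewrite big_split sumrB big_split /=; congr (_ - _ + _).
    rewrite exchange_big /=; apply: eq_bigr => a _.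
    by rewrite mulmxA [RHS]mxE.
  by rewrite -mulmxA [RHS]mxE; apply: eq_bigr => c _; rewrite [(V x)^T _ _]mxE.
have F2 : \sum_a \sum_c H a c * (cov G V a x c 0 - (A a x *m V x) c 0) =
    \tr (H *m H) - T1.
  transitivity (\sum_a (\sum_c H a c * H c a - \sum_c H a c * (A a x *m V x) c 0)).
    apply: eq_bigr => a _; rewrite -sumrB; apply: eq_bigr => c _.
    by rewrite mulrBr -nablaE.
  rewrite sumrB; congr (_ - _); first by apply: eq_bigr => a _; rewrite mxE.
  rewrite /T1 /mxtrace.
  under eq_bigr => a _ do under eq_bigr => c _ do rewrite mxE mulr_sumr.
  under [RHS]eq_bigr => c _ do rewrite mulr_sumr.
  under [RHS]eq_bigr => c _ do under eq_bigr => a _ do rewrite mxE mulr_sumr.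
  rewrite exchange_big /= [RHS]exchange_big /=; apply: eq_bigr => a _.
  rewrite [RHS]exchange_big /=; apply: eq_bigr => c _; apply: eq_bigr => k _.
  by rewrite (conn_sym HG c k a Ux); ring.
rewrite F1 F2 -/T2; ring.
Qed.
End Gradient.

(** * Bochner's formula and the function [P] *)

Section Bochner.
Context {R : realType} {n : nat} {U : set 'rV[R]_n} {G : 'rV[R]_n -> 'M[R]_n}.
Context (HG : metric_on U G).
Local Notation oU := (metric_on_open HG).
Local Notation sG := (metric_on_smooth HG).
Local Notation Gsym := (metric_on_sym HG).
Local Notation A := (conn G).
Local Notation Rm := (curv G).
Implicit Types (x y : 'rV[R]_n) (i j k l a b c : 'I_n) (f u v : 'rV[R]_n -> R).
Implicit Types (V W : 'rV[R]_n -> 'cV[R]_n).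

Lemma grad2_sum u x : grad2 G u x = \sum_c pd c u x * grad G u x c 0.
Proof.
by rewrite grad2.unlock mxE; apply: eq_bigr => c _; rewrite mxE dcolE.
Qed.

Lemma grad2_bilin u x : U x -> grad2 G u x = bilin (G x) (grad G u x)^T (grad G u x)^T.
Proof.
move=> Ux; rewrite grad2.unlock /bilin trmxK -(metric_grad HG) //.
by rewrite trmx_mul Gsym.
Qed.

Lemma grad2_inv u x : grad2 G u x = bilin (invmx (G x)) (dcol u x)^T (dcol u x)^T.
Proof. by rewrite grad2.unlock /bilin trmxK gradE mulmxA. Qed.

Lemma grad2_ge0 u x : U x -> 0 <= grad2 G u x.
Proof.
move=> Ux; rewrite grad2_inv; have [->|d0] := eqVneq (dcol u x)^T 0.
  by rewrite /bilin !mul0mx mxE.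
exact: ltW (posdef_inv (Gsym Ux) (metric_on_posdef HG Ux) d0).
Qed.

Lemma smooth_grad2 u : smooth_on U u -> smooth_on U (grad2 G u).
Proof.
move=> su; have := smooth_mxM oU (smooth_mxT oU (smooth_dcol HG su)) (smooth_grad HG su).
by move=> /(_ 0 0); apply: smooth_eq => [|x _]; [exact: oU|rewrite grad2.unlock].
Qed.

Lemma pd_grad2 u x a : smooth_on U u -> U x ->
  pd a (grad2 G u) x = 2 * (hess G u x *m grad G u x) a 0.
Proof.
move=> su Ux.
have dd : derivable_mx x a (dcol u) := smooth_mx_derivable (smooth_dcol HG su) Ux.
have dV : derivable_mx x a (grad G u) := smooth_mx_derivable (smooth_grad HG su) Ux.
have -> : pd a (grad2 G u) x = dM x a (fun y => (dcol u y)^T *m grad G u y) 0 0.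
  by rewrite dME; apply: pd_eq => y; rewrite grad2.unlock.
rewrite (dMM (derivable_mxT dd) dV) dMT (dM_dcol HG a su Ux).
have -> : dM x a (grad G u) = cov G (grad G u) a x - A a x *m grad G u x.
  by rewrite covE addrK.
have E : hess G u x *m grad G u x = (nabla G (grad G u) x)^T *m dcol u x.
  rewrite -(hess_sym HG su Ux) (hess_nabla HG su Ux) trmx_mul Gsym // -mulmxA.
  by rewrite (metric_grad HG).
have C : (hess G u x *m grad G u x) a 0 = ((dcol u x)^T *m cov G (grad G u) a x) 0 0.
  rewrite E [LHS]mxE [RHS]mxE; apply: eq_bigr => l _.
  by rewrite [_^T a l]mxE nablaE [_^T 0 l]mxE mulrC.
have D : ((G x *m cov G (grad G u) a x)^T *m grad G u x) 0 0 =
    ((dcol u x)^T *m cov G (grad G u) a x) 0 0.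
  have tr1 (M : 'M[R]_1) : M 0 0 = M^T 0 0 by rewrite mxE.
  rewrite [LHS]tr1 trmx_mul trmxK mulmxA.
  by rewrite -(metric_grad HG u Ux) trmx_mul Gsym.
rewrite C trmxD mulmxDl mulmxBr !mxDE mxNE D trmx_mul trmxK mulmxA; ring.
Qed.

Lemma grad_grad2 u x : smooth_on U u -> U x ->
  grad G (grad2 G u) x = 2 *: (nabla G (grad G u) x *m grad G u x).
Proof.
move=> su Ux; rewrite gradE.
have -> : dcol (grad2 G u) x = 2 *: (hess G u x *m grad G u x).
  by apply/colP => a; rewrite dcolE pd_grad2 // [RHS]mxE.
rewrite -scalemxAr mulmxA (hess_nabla HG su Ux) mulmxA mulVmx ?mul1mx //.
exact (metric_unit HG Ux).
Qed.

Lemma nabla_on V W x : (forall y, U y -> V y = W y) -> U x -> nabla G V x = nabla G W x.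
Proof.
move=> VW Ux; apply/matrixP => l a; rewrite !nablaE !covE VW //.
by rewrite (dM_on oU a VW Ux).
Qed.

Lemma trace_nablaZ f V x : smooth_on U f -> smooth_mx U V -> U x ->
  \tr (nabla G (fun y => f y *: V y) x) =
  \sum_a pd a f x * V x a 0 + f x * \tr (nabla G V x).
Proof.
move=> sf sV Ux; rewrite !trace_nabla mulr_sumr -big_split /=; apply: eq_bigr => a _.
rewrite !covE !mxDE -scalemxAr [X in _ + X = _]mxE mulrDr addrA; congr (_ + _).
rewrite !dME -(pdM (smooth_derivable sf Ux) (smooth_derivable (sV a 0) Ux)).
by apply: pd_eq => y; rewrite mxE.
Qed.

Lemma trace_nablaD V W x : smooth_mx U V -> smooth_mx U W -> U x ->
  \tr (nabla G (fun y => V y + W y) x) = \tr (nabla G V x) + \tr (nabla G W x).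
Proof.
move=> sV sW Ux; rewrite !trace_nabla -big_split /=; apply: eq_bigr => a _.
rewrite !covE (dMD (smooth_mx_derivable sV Ux) (smooth_mx_derivable sW Ux)).
by rewrite mulmxDr !mxDE addrACA.
Qed.

(** As the Hessian is symmetric, the gradient of |V|^2 is twice nabla_V V for [V = grad G u], and
    [div_nabla] applies. *)
Lemma lap_grad2 u x : smooth_on U u -> U x ->
  lap G (grad2 G u) x = 2 * (\tr (nabla G (grad G u) x *m nabla G (grad G u) x)
   + \sum_c grad G u x c 0 * pd c (lap G u) x
   + bilin (ric G x) (grad G u x)^T (grad G u x)^T).
Proof.
move=> su Ux; have sV := smooth_grad HG su.
rewrite (lap_div HG (smooth_grad2 su) Ux).
rewrite (nabla_on (W := fun y => 2 *: (nabla G (grad G u) y *m grad G u y))) //; last first.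
  by move=> y Uy; exact: grad_grad2.
have sW := smooth_mxM oU (smooth_nabla HG sV) sV.
rewrite (trace_nablaZ (smooth_cst 2) sW Ux) (div_nabla HG sV Ux).
rewrite big1 ?add0r => [|a _]; last by rewrite pd_cst mul0r.
congr (2 * (_ + _ + _)); last by rewrite /bilin trmxK.
apply: eq_bigr => c _; congr (_ * _); apply: (pd_on oU c _ Ux) => y Uy.
by rewrite (lap_div HG su Uy).
Qed.

Lemma lapD u v x : smooth_on U u -> smooth_on U v -> U x ->
  lap G (fun y => u y + v y) x = lap G u x + lap G v x.
Proof.
move=> su sv Ux; have suv := smoothD oU su sv.
rewrite !(lap_div HG) // -(trace_nablaD (smooth_grad HG su) (smooth_grad HG sv) Ux).
congr (\tr _); apply: nabla_on => // y Uy; rewrite !gradE -mulmxDr; congr (_ *m _).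
apply/colP => a; rewrite mxDE !dcolE.
exact: pdD (smooth_derivable su Uy) (smooth_derivable sv Uy).
Qed.

Lemma lap_sqr u x : smooth_on U u -> U x ->
  lap G (fun y => u y * u y) x = 2 * (u x * lap G u x + grad2 G u x).
Proof.
move=> su Ux; have su2 := smoothM oU su su.
rewrite (lap_div HG su2 Ux).
have s2u := smoothM oU (smooth_cst 2) su.
rewrite (nabla_on (W := fun y => (2 * u y) *: grad G u y)) //; last first.
  move=> y Uy; rewrite !gradE scalemxAr; congr (_ *m _); apply/colP => a.
  rewrite mxE !dcolE (pdM (smooth_derivable su Uy) (smooth_derivable su Uy)); ring.
rewrite (trace_nablaZ s2u (smooth_grad HG su) Ux) -(lap_div HG su Ux) grad2_sum.
rewrite mulrDr mulr_sumr addrC mulrA; congr (_ + _); apply: eq_bigr => a _.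
rewrite (pdM (smooth_derivable (smooth_cst 2) Ux) (smooth_derivable su Ux)) pd_cst; ring.
Qed.

Lemma lap_exp u x : smooth_on U u -> U x ->
  lap G (fun y => expR (u y)) x = expR (u x) * (grad2 G u x + lap G u x).
Proof.
move=> su Ux; have se := smooth_expR oU su.
have pdexp a y : U y -> pd a (fun z => expR (u z)) y = expR (u y) * pd a u y.
  move=> Uy; rewrite !pdE.
  have [_] := pderiv_comp1 (smooth_derivable (i := a) su Uy) (@derivable_expR R (u y)).
  by have E := @derive_expR R; move: (congr1 (fun h : R -> R => h (u y)) E) => /= ->.
rewrite (lap_div HG se Ux).
rewrite (nabla_on (W := fun y => expR (u y) *: grad G u y)) //; last first.
  move=> y Uy; rewrite !gradE scalemxAr; congr (_ *m _); apply/colP => a.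
  by rewrite mxE !dcolE pdexp.
rewrite (trace_nablaZ se (smooth_grad HG su) Ux) -(lap_div HG su Ux) grad2_sum.
rewrite mulrDr mulr_sumr; congr (_ + _); apply: eq_bigr => a _.
by rewrite pdexp // mulrA.
Qed.

Lemma lapZ (e : R) u x : smooth_on U u -> U x -> lap G (fun y => e * u y) x = e * lap G u x.
Proof.
move=> su Ux; have seu := smoothM oU (smooth_cst e) su.
rewrite (lap_div HG seu Ux) (nabla_on (W := fun y => e *: grad G u y)) //; last first.
  move=> y Uy; rewrite !gradE scalemxAr; congr (_ *m _); apply/colP => a.
  by rewrite mxE !dcolE (pdM (smooth_derivable (smooth_cst e) Uy) (smooth_derivable su Uy)) pd_cst mul0r add0r.
rewrite (trace_nablaZ (smooth_cst e) (smooth_grad HG su) Ux) -(lap_div HG su Ux).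
by rewrite big1 ?add0r // => a _; rewrite pd_cst mul0r.
Qed.

Definition obata u x : R := grad2 G u x + u x * u x.

Lemma smooth_obata u : smooth_on U u -> smooth_on U (obata u).
Proof. by move=> su; exact (smoothD oU (smooth_grad2 su) (smoothM oU su su)). Qed.

Section Eigenfunction.
Context (u : 'rV[R]_n -> R) (su : smooth_on U u).
Context (eig : forall x, U x -> lap G u x = - (n%:R * u x)).

(** With H = nabla V and tr H = - n u, the trace of (H + u)^2 is tr H^2 - n u^2. Half the Laplacian
    of u^2 is - n u^2 + |V|^2: its first term completes the square, its second changes the - n |V|^2
    of Bochner's formula into - (n - 1) |V|^2. *)
Lemma lap_obata x : U x -> lap G (obata u) x =
  2 * (\tr (invmx (G x) *m (hess G u x + u x *: G x) *m
            (invmx (G x) *m (hess G u x + u x *: G x)))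
   + (bilin (ric G x) (grad G u x)^T (grad G u x)^T
      - (n%:R - 1) * bilin (G x) (grad G u x)^T (grad G u x)^T)).
Proof.
move=> Ux.
rewrite (lapD (smooth_grad2 su) (smoothM oU su su) Ux) (lap_grad2 su Ux) (lap_sqr su Ux).
rewrite eig // -(grad2_bilin u Ux).
have -> : \sum_c grad G u x c 0 * pd c (lap G u) x = - (n%:R * grad2 G u x).
  rewrite grad2_sum mulr_sumr -sumrN; apply: eq_bigr => c _.
  rewrite (pd_on oU c eig Ux).
  have dnu : derivable (fun y => n%:R * u y) x (delta_mx 0 c).
    exact (smooth_derivable (smoothM oU (smooth_cst n%:R) su) Ux).
  rewrite (pdN dnu) (pdM (smooth_derivable (smooth_cst _) Ux) (smooth_derivable su Ux)) pd_cst.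
  ring.
have -> : invmx (G x) *m (hess G u x + u x *: G x) = nabla G (grad G u) x + (u x)%:M.
  rewrite (hess_nabla HG su Ux) mulmxDr mulmxA -scalemxAr mulVmx; last exact (metric_unit HG Ux).
  by rewrite mul1mx scalemx1.
rewrite mulmxDl !mulmxDr !mxtraceD mul_scalar_mx mul_mx_scalar mul_scalar_mx !mxtraceZ mxtrace_scalar.
rewrite -(lap_div HG su Ux) eig // -mulr_natl; ring.
Qed.

Context (x : 'rV[R]_n) (Ux : U x).
Context (Ric : forall v : 'rV[R]_n, (n%:R - 1) * bilin (G x) v v <= bilin (ric G x) v v).

Let hess_obata_sym : (hess G u x + u x *: G x)^T = hess G u x + u x *: G x.
Proof. by rewrite trmxD (hess_sym HG su Ux) linearZ /= Gsym. Qed.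

Lemma lap_obata_ge0 : 0 <= lap G (obata u) x.
Proof.
rewrite lap_obata // mulr_ge0 // addr_ge0 ?subr_ge0 ?Ric //.
exact: trace_sq_ge0 (Gsym Ux) (metric_on_posdef HG Ux) _ hess_obata_sym.
Qed.

(** Two nonnegative terms add up to zero, so the squared norm of [hess G u x + u x *: G x]
    vanishes. *)
Lemma lap_obata_eq0 : lap G (obata u) x = 0 -> hess G u x = - u x *: G x.
Proof.
rewrite lap_obata // => /eqP; rewrite mulf_eq0 pnatr_eq0 /=.
have T := trace_sq_ge0 (Gsym Ux) (metric_on_posdef HG Ux) hess_obata_sym.
rewrite paddr_eq0 ?subr_ge0 ?Ric // => /andP[/eqP T0 _].
have := trace_sq_eq0 (Gsym Ux) (metric_on_posdef HG Ux) hess_obata_sym T0.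
by move/eqP; rewrite addr_eq0 => /eqP ->; rewrite scaleNr.
Qed.
End Eigenfunction.
End Bochner.

(** * The contracted Bianchi identity *)

HB.lock Definition scal {R : realType} {n : nat} (G : 'rV[R]_n -> 'M[R]_n) (x : 'rV[R]_n) : R :=
  trace_mx (G x) (ric G x).

HB.lock Definition ric_up {R : realType} {n : nat} (G : 'rV[R]_n -> 'M[R]_n) (x : 'rV[R]_n) :
  'M[R]_n := ric G x *m invmx (G x).

Section ContractedBianchi.
Context {R : realType} {n : nat} {U : set 'rV[R]_n} {G : 'rV[R]_n -> 'M[R]_n}.
Context (HG : metric_on U G).
Local Notation oU := (metric_on_open HG).
Local Notation sG := (metric_on_smooth HG).
Local Notation Gsym := (metric_on_sym HG).
Local Notation A := (conn G).
Local Notation Rm := (curv G).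
Implicit Types (x y : 'rV[R]_n) (i j k l m a b c : 'I_n) (f u v : 'rV[R]_n -> R).

Lemma ric_tr x : U x -> (ric G x)^T = ric G x.
Proof. by move=> Ux; rewrite ric.unlock (ricci_sym HG Ux). Qed.

Lemma ric_up_sum x b m : ric_up G x b m = \sum_c curv_up G c b x c m.
Proof.
rewrite ric_up.unlock mxE ric.unlock.
under eq_bigr do rewrite ricciE mulr_suml.
by rewrite exchange_big; apply: eq_bigr => c _; rewrite curv_upE mxE.
Qed.

Lemma ric_up_sumC x b m : U x -> ric_up G x b m = \sum_c curv_up G b c x m c.
Proof.
move=> Ux; rewrite ric_up_sum; apply: eq_bigr => c _.
by rewrite curv_upC mxNE (curv_up_skewE HG b c m c Ux) opprK.
Qed.

Lemma scal_ric_up x : scal G x = \sum_b ric_up G x b b.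
Proof. by rewrite scal.unlock ric_up.unlock /trace_mx mxtrace_mulC. Qed.

Lemma smooth_ric_up : smooth_mx U (ric_up G).
Proof.
move=> b m.
have sC := @smooth_sum R n U oU _ (index_enum 'I_n) xpredT (fun c x => curv_up G c b x c m)
  (fun c _ => smooth_curv_up HG c b c m).
by apply: smooth_eq sC => [|x _]; [exact: oU|rewrite ric_up_sum].
Qed.

Lemma smooth_scal : smooth_on U (scal G).
Proof.
apply: smooth_eq (smooth_trace HG smooth_ric_up) => [|x _]; first exact: oU.
by rewrite scal_ric_up.
Qed.

(** This is dS = 2 div Ric in coordinates, with all connection terms written out; the one belonging
    to the lower index of the Ricci tensor has been moved to the left. It is the double trace of the
    second Bianchi identity. *)
Lemma contracted_bianchi x a : U x ->
  pd a (scal G) x + 2 * (\sum_b \sum_m A a x b m * ric_up G x b m) =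
  2 * (\sum_b pd b (fun y => ric_up G y a b) x + \sum_b \sum_m A b x b m * ric_up G x a m).
Proof.
move=> Ux.
have dC b c d : derivable_mx x d (curv_up G b c) := smooth_mx_derivable (smooth_curv_up HG b c) Ux.
have dr d : derivable_mx x d (ric_up G) := smooth_mx_derivable smooth_ric_up Ux.
pose B d b c := dcurv_up G d b c x.
have BE d b c p q : B d b c p q = pd d (fun y => curv_up G b c y p q) x
    + \sum_m A d x p m * curv_up G b c x m q
    + \sum_m curv_up G b c x p m * A d x q m.
  rewrite /B dcurv_up.unlock !mxDE dME [X in _ + X + _ = _]mxE [X in _ + X = _]mxE.
  by congr (_ + _); apply: eq_bigr => m _; rewrite [_^T _ _]mxE.
have BC d b c p q : B d c b p q = - B d b c p q.
  rewrite !BE !opprD -!sumrN.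
  have -> : pd d (fun y => curv_up G c b y p q) x = - pd d (fun y => curv_up G b c y p q) x.
    by rewrite -(pdN (dC b c d p q)); apply: pd_eq => y; rewrite curv_upC mxNE.
  by congr (_ + _ + _); apply: eq_bigr => m _; rewrite (curv_upC b c) mxNE ?mulrN ?mulNr.
have BS d b c p q : B d b c p q = - B d b c q p.
  rewrite !BE !opprD -!sumrN.
  have -> : pd d (fun y => curv_up G b c y p q) x = - pd d (fun y => curv_up G b c y q p) x.
    rewrite -(pdN (dC b c d q p)); apply: (pd_on oU d _ Ux) => y Uy.
    by rewrite (curv_up_skewE HG b c q p Uy).
  rewrite -!addrA; congr (_ + _); rewrite addrC.
  by congr (_ + _); apply: eq_bigr => m _;
    rewrite (curv_up_skewE HG b c _ _ Ux) ?mulrN ?mulNr mulrC.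
have T1 : \sum_b \sum_c B a b c b c =
    pd a (scal G) x + 2 * (\sum_b \sum_m A a x b m * ric_up G x b m).
  under eq_bigr => b _ do under eq_bigr => c _ do rewrite BE.
  under eq_bigr => b _ do rewrite !big_split /=.
  rewrite !big_split /= mulr2n mulrDl mul1r addrA; congr (_ + _ + _).
  - have -> : pd a (scal G) x = pd a (fun y => \sum_b \sum_c curv_up G b c y b c) x.
      apply: (pd_on oU a _ Ux) => y Uy; rewrite scal_ric_up; apply: eq_bigr => b _.
      exact: ric_up_sumC.
    rewrite pd_sum => [|b]; last by apply: derivable_bigsum => c; exact: dC.
    by apply: eq_bigr => b _; rewrite (pd_sum (fun c => dC b c a b c)).
  - apply: eq_bigr => b _; rewrite exchange_big /=; apply: eq_bigr => m _.
    by rewrite (ric_up_sumC _ _ Ux) mulr_sumr.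
  rewrite exchange_big /=; apply: eq_bigr => c _; rewrite exchange_big /=.
  by apply: eq_bigr => m _; rewrite ric_up_sum mulr_sumr; apply: eq_bigr => b _; rewrite mulrC.
have T2 : \sum_b \sum_c B b c a b c =
    - (\sum_b pd b (fun y => ric_up G y a b) x + \sum_b \sum_m A b x b m * ric_up G x a m).
  under eq_bigr => b _ do under eq_bigr => c _ do rewrite BE.
  under eq_bigr => b _ do rewrite !big_split /=.
  (* This sum pairs the curvature, antisymmetric in [b] and [m], with a connection coefficient
     symmetric in them. *)
  rewrite !big_split /= [X in _ + X](_ : _ = 0) ?addr0; last first.
    rewrite exchange_big /= big1 // => c _.
    have E : \sum_b \sum_m curv_up G c a x b m * A b x c m
        = - \sum_b \sum_m curv_up G c a x b m * A b x c m.
      rewrite [X in _ = - X]exchange_big -sumrN /=; apply: eq_bigr => b _.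
      rewrite -sumrN; apply: eq_bigr => m _.
      by rewrite (curv_up_skewE HG c a _ _ Ux) mulNr (conn_sym HG b m c Ux).
    by move: (\sum_b _) E => t; lra.
  have N y b m : U y -> \sum_c curv_up G c a y b c = - ric_up G y a b.
    move=> Uy; rewrite (ric_up_sumC _ _ Uy) -sumrN; apply: eq_bigr => c _.
    by rewrite curv_upC mxNE.
  rewrite opprD -!sumrN; congr (_ + _); apply: eq_bigr => b _.
    rewrite -(pd_sum (fun c => dC c a b b c)) -(pdN (dr b a b)).
    by apply: (pd_on oU b _ Ux) => y Uy; exact: N.
  rewrite exchange_big -sumrN /=; apply: eq_bigr => m _.
  by rewrite -mulr_sumr N // mulrN.
(* Exchanging [b] and [c] changes the sign twice, once for each antisymmetric pair, so two of the
   three traces agree; this is the factor 2 in the result. *)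
have T3 : \sum_b \sum_c B c a b b c = \sum_b \sum_c B b c a b c.
  rewrite exchange_big /=; apply: eq_bigr => b _; apply: eq_bigr => c _.
  by rewrite BC BS opprK.
have Z : \sum_b \sum_c (B a b c b c + B b c a b c + B c a b b c) = 0.
  apply: big1 => b _; apply: big1 => c _; rewrite /B -!mxDE (second_bianchi HG a b c Ux).
  by rewrite mxE.
move: Z; under eq_bigr => b _ do rewrite !big_split /=.
rewrite !big_split /= T3 T1 T2.
by move: (pd a _ x + _) (\sum_b pd b _ x + _) => s t; lra.
Qed.

(** * Consequences of Hess u = - u g *)

Section ConcircularField.
Context (u : 'rV[R]_n -> R) (su : smooth_on U u).
Context (Hu : forall x, U x -> hess G u x = - u x *: G x).

Lemma cov_concircular x a : U x -> cov G (grad G u) a x = - u x *: delta_mx a 0.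
Proof.
move=> Ux; have : nabla G (grad G u) x = (- u x)%:M.
  have Gu := metric_unit HG Ux.
  rewrite -(mulKmx Gu (nabla _ _ _)) -(hess_nabla HG su Ux) Hu // -scalemxAr mulVmx //.
  by rewrite scalemx1.
move=> /matrixP E; apply/colP => l; rewrite -nablaE E !mxE eqxx andbT.
by rewrite mulr_natr.
Qed.

(** With nabla V = - u id the Ricci identity reads R(d_a, d_c) V = (d_c u) d_a - (d_a u) d_c;
    tracing over [a] counts d_c u [n] times and removes it once. *)
Lemma ric_concircular x : U x -> ric G x *m grad G u x = (n%:R - 1) *: dcol u x.
Proof.
move=> Ux; apply/colP => c; rewrite -(ric_sum c (grad G u) Ux) [RHS]mxE dcolE.
have dcov b d : dM x b (cov G (grad G u) d) = - pd b u x *: delta_mx d 0.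
  rewrite (dM_on oU b (fun y => @cov_concircular y d) Ux).
  apply/matrixP => p q; rewrite dME [RHS]mxE.
  pose e : R := (delta_mx d 0 : 'cV[R]_n) p q.
  have -> : pd b (fun y => (- u y *: delta_mx d 0 : 'cV[R]_n) p q) x =
      pd b (fun y => (- e) * u y) x.
    by apply: pd_eq => y; rewrite [LHS]mxE -/e; ring.
  rewrite (pdM (smooth_derivable (smooth_cst (- e)) Ux) (smooth_derivable su Ux)) pd_cst -/e.
  ring.
have RI a : (Rm a c x *m grad G u x) a 0 = pd c u x - (a == c)%:R * pd a u x.
  rewrite -(ricci_identity HG a c (smooth_grad HG su) Ux) !dcov !cov_concircular //.
  have E : A a x *m delta_mx c (0 : 'I_1) = A c x *m delta_mx a 0.
    by rewrite -!colE; apply/colP => l; rewrite !mxE (conn_sym HG a c l Ux).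
  have mxZE (k : R) (X : 'cV[R]_n) : (k *: X) a 0 = k * X a 0 by rewrite mxE.
  rewrite -!scalemxAr E !(mxDE, mxNE, mxZE).
  move: ((A c x *m _) a 0) => w; rewrite !mxE !eqxx !andbT mulr1; ring.
rewrite (eq_bigr _ (fun a _ => RI a)) sumrB sumr_const card_ord -[_ *+ n]mulr_natl.
rewrite (bigD1 c) //= eqxx mul1r big1 => [|a /negPf ->]; last by rewrite mul0r.
by rewrite addr0 mulrBl mul1r.
Qed.

(** Pair dS = 2 div Ric with V. By the product rule, (div Ric)(V) is div(Ric V) minus the trace of
    Ric against nabla V, that is, (n - 1) div V + u S, and div V = - n u. *)
Lemma scal_concircular x : U x ->
  \sum_a grad G u x a 0 * pd a (scal G) x = 2 * (u x * (scal G x - n%:R * (n%:R - 1))).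
Proof.
move=> Ux; pose V := grad G u.
have dV b : derivable_mx x b V := smooth_mx_derivable (smooth_grad HG su) Ux.
have dr d : derivable_mx x d (ric_up G) := smooth_mx_derivable smooth_ric_up Ux.
have rV y b : U y -> \sum_a V y a 0 * ric_up G y a b = (n%:R - 1) * V y b 0.
  move=> Uy; have : (V y)^T *m ric_up G y = (n%:R - 1) *: (V y)^T.
    rewrite ric_up.unlock mulmxA -[ric G y]trmxK -trmx_mul ric_tr //.
    rewrite ric_concircular // linearZ /= -scalemxAl /V gradE trmx_mul.
    by rewrite invmx_sym ?Gsym.
  move=> /matrixP/(_ 0 b); rewrite !mxE => <-.
  by apply: eq_bigr => a _; rewrite mxE.
have dVE a b : pd b (fun y => V y a 0) x = - u x * (a == b)%:R - (A b x *m V x) a 0.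
  rewrite -dME; have -> : dM x b V = cov G V b x - A b x *m V x by rewrite covE addrK.
  by rewrite cov_concircular // mxDE mxNE !mxE eqxx andbT.
(* [Q] and [D] name the connection terms of the three sums below; in the final combination
   [E3 + E2 - E1] both disappear. *)
pose Q := \sum_b \sum_a (A b x *m V x) a 0 * ric_up G x a b.
pose D := \sum_b \sum_m A b x b m * V x m 0.
have E1 : \sum_a V x a 0 * (\sum_b \sum_m A a x b m * ric_up G x b m) = Q.
  rewrite /Q; under eq_bigr => a _ do rewrite mulr_sumr.
  rewrite exchange_big /= [RHS]exchange_big /=; apply: eq_bigr => b _.
  under eq_bigr => a _ do rewrite mulr_sumr.
  rewrite exchange_big /=; apply: eq_bigr => m _.
  rewrite mxE mulr_suml; apply: eq_bigr => a _.
  by rewrite (conn_sym HG a m b Ux); ring.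
have E2 : \sum_a V x a 0 * (\sum_b \sum_m A b x b m * ric_up G x a m) =
    (n%:R - 1) * D.
  under eq_bigr => a _ do rewrite mulr_sumr.
  rewrite exchange_big /D mulr_sumr /=; apply: eq_bigr => b _.
  under eq_bigr => a _ do rewrite mulr_sumr.
  rewrite exchange_big mulr_sumr /=; apply: eq_bigr => m _.
  rewrite [RHS]mulrCA -rV // mulr_sumr; apply: eq_bigr => a _; ring.
have E3 : \sum_a V x a 0 * (\sum_b pd b (fun y => ric_up G y a b) x) =
    (n%:R - 1) * (- u x * n%:R - D) + u x * scal G x + Q.
  under eq_bigr => a _ do rewrite mulr_sumr.
  rewrite exchange_big /=.
  have F b : \sum_a V x a 0 * pd b (fun y => ric_up G y a b) x =
      (n%:R - 1) * (- u x - \sum_m A b x b m * V x m 0) + u x * ric_up G x b b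
      + \sum_a (A b x *m V x) a 0 * ric_up G x a b.
    have P : \sum_a (pd b (fun y => V y a 0) x * ric_up G x a b
         + V x a 0 * pd b (fun y => ric_up G y a b) x) = (n%:R - 1) * pd b (fun y => V y b 0) x.
      transitivity (pd b (fun y => \sum_a V y a 0 * ric_up G y a b) x).
        rewrite pd_sum => [|a]; last exact: derivableM (dV b a 0) (dr b a b).
        by apply: eq_bigr => a _; rewrite (pdM (dV b a 0) (dr b a b)).
      rewrite (pd_on oU b (fun y Uy => rV y b Uy) Ux).
      rewrite (pdM (smooth_derivable (smooth_cst _) Ux) (dV b b 0)) pd_cst.
      by rewrite mul0r add0r.
    move: P; rewrite big_split /= => /esym/eqP; rewrite [X in _ == X]addrC -subr_eq => /eqP <-.
    rewrite dVE eqxx mulr1 [X in _ * (_ - X)]mxE -addrA; congr (_ + _).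
    transitivity (\sum_a (u x * ((a == b)%:R * ric_up G x a b)
        + (A b x *m V x) a 0 * ric_up G x a b)).
      by rewrite -sumrN; apply: eq_bigr => a _; rewrite dVE; ring.
    rewrite big_split /= -mulr_sumr; congr (_ * _ + _).
    rewrite (bigD1 b) //= eqxx mul1r big1 ?addr0 // => a /negPf ->.
    by rewrite mul0r.
  rewrite (eq_bigr _ (fun b _ => F b)) !big_split /= -!mulr_sumr -scal_ric_up.
  by rewrite sumrB sumr_const card_ord -/D -[- u x *+ n]mulr_natr.
have CB a : V x a 0 * pd a (scal G) x = 2 * (V x a 0 * (\sum_b pd b (fun y => ric_up G y a b) x)
     + V x a 0 * (\sum_b \sum_m A b x b m * ric_up G x a m)
     - V x a 0 * (\sum_b \sum_m A a x b m * ric_up G x b m)).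
  have /eqP := contracted_bianchi a Ux; rewrite eq_sym -subr_eq => /eqP <-; ring.
rewrite (eq_bigr _ (fun a _ => CB a)) -mulr_sumr !big_split /= sumrN E1 E2 E3; ring.
Qed.
End ConcircularField.
End ContractedBianchi.

(** * The strong maximum principle *)

Section SecondDerivativeTest.
Context {R : realType} {n : nat} {U : set 'rV[R]_n} (oU : open U).
Implicit Types (x y v : 'rV[R]_n) (i j : 'I_n) (u : 'rV[R]_n -> R).

Lemma smooth_derive_line u x v (t : R) : smooth_on U u -> U (x + t *: v) ->
  is_derive t 1 (fun s : R => u (x + s *: v)) (\sum_i v 0 i * pd i u (x + t *: v)).
Proof.
move=> su Ux.
have du := smooth_differentiable oU su Ux.
have -> : \sum_i v 0 i * pd i u (x + t *: v) = 'D_v u (x + t *: v).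
  by rewrite (differentiable_deriveE v du); apply: eq_bigr => i _; rewrite pdE.
by apply: is_derive_line; exact: diff_derivable.
Qed.

Lemma line_near x v (P : 'rV[R]_n -> Prop) : (\forall y \near x, P y) ->
  \forall t \near (0 : R), P (x + t *: v).
Proof.
have c : (fun t : R => x + t *: v) @ (0 : R) --> x.
  rewrite -[X in _ --> X]addr0 -(scale0r v).
  by apply: cvgD; [exact: cvg_cst|apply: cvgZr_tmp; exact: cvg_id].
by move=> /c.
Qed.

Section LocalMax.
Context (u : 'rV[R]_n -> R) (x : 'rV[R]_n) (su : smooth_on U u) (Ux : U x).
Context (umax : \forall y \near x, u y <= u x).

Let line0 v : x + (0 : R) *: v = x.
Proof. by rewrite scale0r addr0. Qed.

Lemma local_max_line v : exists2 r : R, 0 < r &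
  forall t : R, `|t| < r -> U (x + t *: v) /\ u (x + t *: v) <= u x.
Proof.
have nr : \forall t \near (0 : R), U (x + t *: v) /\ u (x + t *: v) <= u x.
  apply: (@line_near x v (fun y => U y /\ u y <= u x)); apply: filterI umax.
  exact: open_nbhs_nbhs.
move/nbhs_ballP: nr => [r /= r0 Hr]; exists r => // t tr; apply: Hr.
by rewrite /ball /= sub0r normrN.
Qed.

Lemma local_max_derive v : \sum_i v 0 i * pd i u x = 0.
Proof.
have [r r0 Hr] := local_max_line v.
have Hr' t : t \in `](- r), r[%R -> U (x + t *: v) /\ u (x + t *: v) <= u x.
  by rewrite in_itv /= -ltr_norml => /Hr.
have r00 : (0 : R) \in `](- r), r[%R by rewrite in_itv /= oppr_lt0 r0.
have [|||_ D] := @derive1_at_max R (fun t => u (x + t *: v)) (- r) r 0 _ _ r00.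
- lra.
- by move=> t /Hr'[Ut _]; have [] := smooth_derive_line su Ut.
- by move=> t /Hr'[_]; rewrite line0.
have Ux0 : U (x + (0 : R) *: v) by rewrite line0.
have [_] := smooth_derive_line su Ux0.
by rewrite line0 D.
Qed.

Lemma local_max_pd i : pd i u x = 0.
Proof.
have := local_max_derive (delta_mx 0 i); rewrite (bigD1 i) //= big1 => [|j ji].
  by rewrite mxE !eqxx mul1r addr0.
by rewrite mxE (negPf ji) andbF mul0r.
Qed.

(** Were the sum positive, the slope [psi] along the line, zero at the maximum, would be positive
    just after it, and the mean value theorem would carry [u] above [u x]. *)
Lemma local_max_hess v : \sum_i v 0 i * (\sum_j v 0 j * pd j (pd i u) x) <= 0.
Proof.
rewrite leNgt; apply/negP => S0.
have [r r0 Hr] := local_max_line v.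
pose psi t := \sum_i v 0 i * pd i u (x + t *: v).
have dphi (t : R) : `|t| < r -> is_derive t 1 (fun s : R => u (x + s *: v)) (psi t).
  by move=> /Hr[Ut _]; exact: smooth_derive_line.
have Ux0 : U (x + (0 : R) *: v) by rewrite line0.
have psi0 : psi 0 = 0 by rewrite /psi line0; exact: local_max_derive.
have dpsi : is_derive (0 : R) 1 psi (\sum_i v 0 i * (\sum_j v 0 j * pd j (pd i u) x)).
  have -> : psi = \sum_i (fun t => v 0 i * pd i u (x + t *: v)).
    by apply/funext => t; rewrite fct_sumE.
  apply: is_derive_sum => i.
  have [d E] := smooth_derive_line (smooth_pd oU i su) Ux0; rewrite line0 in E.
  apply: DeriveDef; first exact: derivableM (derivable_cst _ _ _) d.
  apply: etrans (deriveM (derivable_cst _ _ _) d) _.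
  by rewrite derive_cst E scaler0 addr0.
have psi_pos : \forall t \near (0 : R)^', 0 < t^-1 * psi t.
  have [/cvg_ex[l] L E] := dpsi.
  have lE : l = \sum_i v 0 i * (\sum_j v 0 j * pd j (pd i u) x).
    by rewrite -E; apply/esym/cvg_lim.
  have := cvgr_gt _ L 0; rewrite lE => /(_ _ S0); apply: filterS => t.
  by rewrite /= [t *: (1 : R)]mulr1 addr0 psi0 subr0.
have /nbhs_ballP[d /= d0 Hd] := psi_pos.
pose t := Num.min r d / 2.
have m0 : 0 < Num.min r d by rewrite lt_min r0.
have t0 : 0 < t by rewrite divr_gt0.
have tm : t < Num.min r d by rewrite /t; lra.
have [tr td] : t < r /\ t < d by move: tm; rewrite lt_min => /andP.
have [||c ct E] := @MVT R (fun s : R => u (x + s *: v)) psi 0 t t0.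
- by move=> s; rewrite in_itv /= => /andP[s0 st]; apply: dphi; rewrite gtr0_norm // (lt_trans st).
- apply/continuous_in_subspaceT => s; rewrite inE /= in_itv /= => /andP[s0 st].
  have [|ds _] := dphi s; first by rewrite ger0_norm // (le_lt_trans st).
  exact/differentiable_continuous/derivable1_diffP.
move: ct; rewrite in_itv /= => /andP[c0 ct].
have : 0 < c^-1 * psi c.
  apply: Hd; last by rewrite gt_eqF.
  by rewrite /ball /= sub0r normrN gtr0_norm // (lt_trans ct).
rewrite pmulr_rgt0 ?invr_gt0 // => pc.
have [|_] := Hr t; first by rewrite gtr0_norm.
rewrite -subr_le0 -[X in _ - u X](line0 v) E subr0 leNgt => /negP; apply.
exact: mulr_gt0.
Qed.

Lemma lap_local_max (G : 'rV[R]_n -> 'M[R]_n) (HG : metric_on U G) : lap G u x <= 0.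
Proof.
rewrite lap.unlock /trace_mx -oppr_ge0.
have -> : - \tr (invmx (G x) *m hess G u x) = trace_mx (G x) (- hess G u x).
  by rewrite /trace_mx mulmxN linearN.
apply: (trace_mx_psd (metric_on_sym HG Ux) (metric_on_posdef HG Ux)) => v.
(* At a critical point the Christoffel terms vanish and the Hessian consists of plain second
   derivatives. *)
have H : hess G u x = \matrix_(i, j) pd i (pd j u) x.
  apply/matrixP => i j; rewrite hessE mxE big1 ?subr0 // => k _.
  by rewrite local_max_pd mulr0.
rewrite /bilin mulmxN mulNmx mxNE oppr_ge0 H.
have := local_max_hess v; congr (_ <= 0); rewrite [RHS]mxE; apply: eq_bigr => i _.
rewrite mulrC [_^T i 0]mxE; congr (_ * _); rewrite mxE; apply: eq_bigr => j _.
by rewrite mxE.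
Qed.
End LocalMax.
End SecondDerivativeTest.

(** * Hopf's strong maximum principle in a chart *)

Section StrongMaximumPrinciple.
Context {R : realType} {n : nat} {U : set 'rV[R]_n} {G : 'rV[R]_n -> 'M[R]_n}.
Context (HG : metric_on U G).
Local Notation oU := (metric_on_open HG).
Implicit Types (x y z : 'rV[R]_n) (i j : 'I_n) (u : 'rV[R]_n -> R).

(** The norm on row vectors is the sup norm, which is not smooth; the barrier needs this Euclidean
    squared distance. *)
Definition sqdist y x : R := \sum_i (x 0 i - y 0 i) * (x 0 i - y 0 i).

Lemma sqdist_ge0 y x : 0 <= sqdist y x.
Proof. by apply: sumr_ge0 => i _; rewrite -expr2 sqr_ge0. Qed.

Lemma smooth_sqdist y (W : set 'rV[R]_n) : open W -> smooth_on W (sqdist y).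
Proof.
move=> oW.
have sc i : smooth_on W (fun x => x 0 i - y 0 i).
  exact (smoothB oW (smooth_coord i) (smooth_cst (y 0 i))).
exact (@smooth_sum R n W oW _ (index_enum 'I_n) xpredT
  (fun i x => (x 0 i - y 0 i) * (x 0 i - y 0 i)) (fun i _ => smoothM oW (sc i) (sc i))).
Qed.

Lemma continuous_sqdist y : continuous (sqdist y).
Proof.
move=> x; exact: (smooth_continuous (smooth_sqdist y (@openT _)) (I : setT x)).
Qed.

Lemma norm_sqdist y x (e : R) : 0 <= e -> sqdist y x <= e ^+ 2 -> `|x - y| <= e.
Proof.
move=> e0 h; apply/row_norm_leP => // i; rewrite !mxE.
rewrite -(@ler_pXn2r _ 2) ?nnegrE // real_normK ?num_real //.
apply: le_trans h; rewrite /sqdist (bigD1 i) //= -expr2 lerDl.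
by apply: sumr_ge0 => j _; rewrite -expr2 sqr_ge0.
Qed.

Lemma compact_sqdist y (I : set R) (s : R) : closed I -> (forall t, I t -> t <= s) ->
  compact (sqdist y @^-1` I).
Proof.
move=> cI Is; apply: bounded_closed_compact; last first.
  by apply: preimage_closed cI => x _; exact: continuous_sqdist.
exists (`|y| + Num.sqrt s); split; first exact: num_real.
move=> M HM x /= /Is xs; apply: le_trans (ltW HM).
have -> : x = y + (x - y) by rewrite addrC subrK.
apply: le_trans (ler_normD _ _) _; rewrite lerD2l.
apply: norm_sqdist; first exact: sqrtr_ge0.
by rewrite sqr_sqrtr // (le_trans (sqdist_ge0 _ _) xs).
Qed.

Lemma pd_sqdist y x i : pd i (sqdist y) x = 2 * (x 0 i - y 0 i).
Proof.
have sc j : smooth_on setT (fun z : 'rV[R]_n => z 0 j - y 0 j).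
  exact (smoothB openT (smooth_coord j) (smooth_cst (y 0 j))).
have dc j : derivable (fun z : 'rV[R]_n => z 0 j - y 0 j) x (delta_mx 0 i).
  exact (smooth_derivable (sc j) I).
have pc j : pd i (fun z : 'rV[R]_n => z 0 j - y 0 j) x = (j == i)%:R.
  have d1 : derivable (fun z : 'rV[R]_n => z 0 j) x (delta_mx 0 i).
    exact (smooth_derivable (smooth_coord j) (I : setT x)).
  have d2 : derivable (fun=> - y 0 j) x (delta_mx 0 i).
    exact (smooth_derivable (smooth_cst (- y 0 j)) (I : setT x)).
  apply: etrans (pdD d1 d2) _.
  by rewrite pd_cst addr0 pdE /pderiv derive_coord mxE eqxx.
rewrite /sqdist pd_sum => [|j]; last exact: derivableM (dc j) (dc j).
rewrite (bigD1 i) //= (pdM (dc i) (dc i)) pc eqxx big1 => [|j /negPf ji] /=.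
  ring.
by rewrite (pdM (dc j) (dc j)) pc ji mul0r mulr0 addr0.
Qed.

Lemma grad2_sqdist_gt0 y x : U x -> 0 < sqdist y x -> 0 < grad2 G (sqdist y) x.
Proof.
move=> Ux xy; rewrite grad2_inv; apply: (posdef_inv (metric_on_sym HG Ux) (metric_on_posdef HG Ux)).
apply/eqP => /matrixP E; move: xy; rewrite /sqdist big1 ?ltxx // => i _.
have := E 0 i; rewrite mxE dcolE pd_sqdist mxE => /eqP.
by rewrite mulf_eq0 pnatr_eq0 /= => /eqP ->; rewrite mul0r.
Qed.

Lemma grad2Z (e : R) u x : smooth_on U u -> U x -> grad2 G (fun z => e * u z) x = e ^+ 2 * grad2 G u x.
Proof.
move=> su Ux; rewrite !grad2_inv.
have -> : dcol (fun z => e * u z) x = e *: dcol u x.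
  apply/colP => a; rewrite mxE !dcolE.
  by rewrite (pdM (smooth_derivable (smooth_cst e) Ux) (smooth_derivable su Ux)) pd_cst mul0r add0r.
have -> : (e *: dcol u x)^T = e *: (dcol u x)^T by rewrite linearZ.
by rewrite /bilin -[(e *: _)^T]/((e *: (dcol u x)^T)^T) linearZ /= -!scalemxAl -scalemxAr scalerA [LHS]mxE expr2.
Qed.

(* Hopf's argument: [expR (- a * sqdist y)] is strictly subharmonic away from
   [y] once [a] is large, and it is larger at [x0] than on the boundary of the
   ball [sqdist y <= s]. *)
Lemma strong_max_ball u (m s : R) x0 y : smooth_on U u ->
  (forall x, U x -> 0 <= lap G u x) -> (forall x, U x -> u x <= m) ->
  u x0 = m -> sqdist y x0 < s -> (forall x, sqdist y x <= s -> U x) ->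
  u y = m.
Proof.
move=> su Lu um ux0 x0s DU; apply/eqP; apply: contraT => uym.
have Uy : U y by apply: DU; rewrite /sqdist big1 ?(le_trans (sqdist_ge0 y x0) (ltW x0s)) // => i _; rewrite subrr mul0r.
have ult : u y < m by rewrite lt_neqAle uym um.
(* Half the gap at [y]. As [w] is at most 1, adding [d * w] cannot lift a value below [m - d] up to
   [m]. *)
pose d := (m - u y) / 2.
have d0 : 0 < d by rewrite divr_gt0 // subr_gt0.
have umd : u y < m - d by rewrite /d; lra.
have [r r0 Hr] : exists2 r : R, 0 < r & forall x, sqdist y x < r -> u x < m - d.
  have cu := smooth_continuous su Uy.
  have nb : \forall x \near y, u x < m - d by exact: (cvgr_lt (u y) cu _ umd).
  move/nbhs_ballP: nb => [e /= e0 He].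
  exists ((e / 2) ^+ 2); first by rewrite exprn_gt0 // divr_gt0.
  move=> x xr; apply: He; rewrite -ball_normE /= distrC.
  by rewrite (le_lt_trans (norm_sqdist _ (ltW xr))) //; lra.
pose K := sqdist y @^-1` `[r, s]%classic.
pose D := sqdist y @^-1` `[0, s]%classic.
have KE x : K x -> r <= sqdist y x /\ sqdist y x <= s.
  by rewrite /K /= in_itv /= => /andP.
have cK : compact K.
  by apply: (@compact_sqdist _ _ s) => [|t]; [exact: itv_closed|rewrite /= in_itv /= => /andP[]].
have cD : compact D.
  by apply: (@compact_sqdist _ _ s) => [|t]; [exact: itv_closed|rewrite /= in_itv /= => /andP[]].
have x0r : r <= sqdist y x0.
  by rewrite leNgt; apply/negP => /Hr; rewrite ux0; lra.
have Kx0 : K x0 by rewrite /K /= in_itv /= x0r ltW.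
have Dx0 : D x0 by rewrite /D /= in_itv /= sqdist_ge0 ltW.
have KU x : K x -> U x by move=> /KE[_]; exact: DU.
have DDU x : D x -> U x by rewrite /D /= in_itv /= => /andP[_]; exact: DU.
have sq := smooth_sqdist y oU.
have contK f (B : set 'rV[R]_n) : smooth_on U f -> B `<=` U -> {within B, continuous f}.
  move=> sf BU; apply/continuous_in_subspaceT => x; rewrite inE => /BU.
  exact: smooth_continuous.
have [z1 Kz1 min1] := compact_EVT_min (ex_intro _ x0 Kx0) cK (contK _ _ (smooth_grad2 HG sq) KU).
have [z2 Kz2 max2] := compact_EVT_max (ex_intro _ x0 Kx0) cK (contK _ _ (smooth_lap HG sq) KU).
set p := grad2 G (sqdist y) z1 in min1.
have p0 : 0 < p.
  move: Kz1; rewrite inE => Kz1; apply: grad2_sqdist_gt0; first exact: KU.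
  by apply: lt_le_trans r0 _; have [] := KE _ Kz1.
set q := lap G (sqdist y) z2 in max2.
(* On the shell [K] the sign of [lap G w] is that of [a * grad2 - lap] for [sqdist y], where [grad2]
   is at least [p] and [lap] at most [q]; here [a * p = |q| + 1 > q]. *)
pose a := (`|q| + 1) / p.
have a0 : 0 < a by rewrite divr_gt0 // ltr_wpDl.
have apq : q < a * p by rewrite /a divfK ?gt_eqF //; rewrite (le_lt_trans (ler_norm q)) // ltrDl.
have sh := smoothM oU (smooth_cst (- a)) sq.
pose w x := expR (- a * sqdist y x).
have sw : smooth_on U w := smooth_expR oU sh.
have Lw x : K x -> 0 < lap G w x.
  move=> Kx; have Ux := KU _ Kx.
  rewrite /w (lap_exp HG sh Ux) (grad2Z _ sq Ux) (lapZ HG _ sq Ux) mulr_gt0 ?expR_gt0 //.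
  have -> : (- a) ^+ 2 * grad2 G (sqdist y) x + - a * lap G (sqdist y) x =
    a * (a * grad2 G (sqdist y) x - lap G (sqdist y) x) by ring.
  rewrite mulr_gt0 // subr_gt0.
  apply: le_lt_trans (max2 x _) _; first by rewrite inE.
  by apply: lt_le_trans apq _; rewrite ler_pM2l //; apply: min1; rewrite inE.
have sdw := smoothM oU (smooth_cst d) sw.
pose v x := u x + d * w x.
have sv : smooth_on U v := smoothD oU su sdw.
(* The maximum over the whole ball lies neither near the centre nor on the boundary, hence inside
   the shell, where [lap G v] is positive. *)
have [z Dz maxz] := compact_EVT_max (ex_intro _ x0 Dx0) cD (contK _ _ sv DDU).
have vx0 : v x0 <= v z by apply: maxz; rewrite inE.
move: Dz; rewrite inE => Dz; have Uz := DDU _ Dz.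
have w_le1 x : w x <= 1.
  by rewrite /w -expR0 ler_expR mulNr oppr_le0 mulr_ge0 ?sqdist_ge0 // ltW.
have w0 x : 0 < w x := expR_gt0 _.
have zr : r <= sqdist y z.
  rewrite leNgt; apply/negP => /Hr uz.
  have : v z < v x0.
    rewrite /v ux0; apply: (@lt_trans _ _ m); last by rewrite ltrDl mulr_gt0.
    have : d * w z <= d by rewrite ler_piMr // ltW.
    lra.
  by rewrite ltNge vx0.
have zs : sqdist y z < s.
  rewrite ltNge; apply/negP => sz.
  have : v z < v x0.
    rewrite /v ux0; apply: ler_ltD; first exact: um.
    rewrite ltr_pM2l // /w ltr_expR !mulNr ltrN2 ltr_pM2l //.
    exact: lt_le_trans x0s sz.
  by rewrite ltNge vx0.
have Kz : K z by rewrite /K /= in_itv /= zr ltW.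
have lmax : \forall x \near z, v x <= v z.
  have nz : \forall x \near z, sqdist y x < s.
    by exact: (cvgr_lt (sqdist y z) (@continuous_sqdist y z) _ zs).
  apply: filterS nz => x xs.
  by apply: maxz; rewrite inE /D /= in_itv /= sqdist_ge0 ltW.
have := lap_local_max oU sv Uz lmax HG.
rewrite (lapD HG su sdw Uz) (lapZ HG d sw Uz) leNgt => /negP[].
by rewrite ltr_wpDl ?Lu // mulr_gt0 // Lw.
Qed.

(** Each [y] near [x0] is the centre of a ball inside [U] that has [x0] in its interior, and
    [strong_max_ball] gives the value at that centre. *)
Lemma strong_max_local u (m : R) x0 : smooth_on U u -> U x0 ->
  (forall x, U x -> 0 <= lap G u x) -> (forall x, U x -> u x <= m) ->
  u x0 = m -> \forall y \near x0, u y = m.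
Proof.
move=> su Ux0 Lu um ux0.
have /nbhs_ballP[r /= r0 Hr] : nbhs x0 U by exact: open_nbhs_nbhs (conj oU Ux0).
(* Both [|y - x0|] and the radius of the ball about [y] are at most [r / 3], so that ball stays
   within [r] of [x0]. *)
pose s := (r / 3) ^+ 2.
have s0 : 0 < s by rewrite exprn_gt0 // divr_gt0.
have sqC y x : sqdist y x = sqdist x y.
  by apply: eq_bigr => i _; ring.
have c0 : sqdist x0 x0 < s by rewrite /sqdist big1 // => i _; rewrite subrr mul0r.
have nz : \forall x \near x0, sqdist x0 x < s.
  by exact: (cvgr_lt (sqdist x0 x0) (@continuous_sqdist x0 x0) _ c0).
apply: filterS nz => y ys.
apply: (@strong_max_ball u m s x0 y) => //; first by rewrite sqC.
move=> x xs; apply: Hr; rewrite -ball_normE /=.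
have r3 : 0 <= r / 3 by rewrite divr_ge0 // ltW.
have h1 := norm_sqdist r3 xs; have h2 := norm_sqdist r3 (ltW ys).
apply: le_lt_trans (ler_distD y _ _) _; rewrite distrC [X in _ + X]distrC.
by apply: le_lt_trans (lerD h2 h1) _; lra.
Qed.
End StrongMaximumPrinciple.

(** * Change of coordinates *)

Section ChainRule.
Context {R : realType} {m n : nat}.

(** [T] is only assumed derivable along [v]; on the line through [x] in that direction the composite
    is a function of one variable. *)
Lemma chain_rule (h : 'rV[R]_n -> R) (T : 'rV[R]_m -> 'rV[R]_n) (x v : 'rV[R]_m) :
  differentiable h (T x) -> derivable T x v ->
  is_derive x v (h \o T) ('D_('D_v T x) h (T x)).
Proof.
move=> dh dT; pose g (t : R) := T (x + t *: v).
have x0 : x + (0 : R) *: v = x by rewrite scale0r addr0.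
have g0 : g 0 = T x by rewrite /g x0.
have [dg Dg] : is_derive (0 : R) 1 g ('D_v T x).
  by have := @is_derive_line R _ _ T x v 0; rewrite x0; apply.
have dg' : differentiable g 0 by exact/derivable1_diffP.
have dh' : differentiable h (g 0) by rewrite g0.
have dhg : derivable (h \o g) 0 1.
  by apply/derivable1_diffP; exact: differentiable_comp.
have D0 : 'D_1 (h \o g) 0 = 'D_('D_v T x) h (T x).
  rewrite (deriveE _ (differentiable_comp dg' dh')) (diff_comp dg' dh') /=.
  by rewrite -(deriveE _ dg') Dg g0 -deriveE.
by rewrite -D0; exact: is_derive_line0.
Qed.
End ChainRule.

Section MatrixIdentities.
Context {R : comPzRingType} {n : nat}.

(** Curvature under the gauge law K A = B K + dK. The last two hypotheses are the law for one
    direction differentiated in the other, and [h] is the common mixed second derivative of [K]. *)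
Lemma curvature_gauge_alg (K Ai Aj dij dji Bi Bj Ki Kj eij eji h : 'M[R]_n) :
  K *m Ai = Bi *m K + Ki -> K *m Aj = Bj *m K + Kj ->
  Ki *m Aj + K *m dij = (eij *m K + Bj *m Ki) + h ->
  Kj *m Ai + K *m dji = (eji *m K + Bi *m Kj) + h ->
  K *m (dij - dji + (Ai *m Aj - Aj *m Ai)) = (eij - eji + (Bi *m Bj - Bj *m Bi)) *m K.
Proof.
move=> Ei Ej Eij Eji.
have Di : Ki = K *m Ai - Bi *m K by rewrite Ei [_ + Ki]addrC addrK.
have Dj : Kj = K *m Aj - Bj *m K by rewrite Ej [_ + Kj]addrC addrK.
have Dij : K *m dij = eij *m K + Bj *m Ki + h - Ki *m Aj by rewrite -Eij addrC addKr.
have Dji : K *m dji = eji *m K + Bi *m Kj + h - Kj *m Ai by rewrite -Eji addrC addKr.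
rewrite mulmxDr mulmxBr Dij Dji Di Dj.
by apply/matrixP => a b; rewrite !(opprD, opprK, mx_lin_simp); ring.
Qed.
End MatrixIdentities.

Section ChangeOfCoordinates.
Context {R : realType} {n : nat} {U U' : set 'rV[R]_n} {G G' : 'rV[R]_n -> 'M[R]_n}.
Context (HG : metric_on U G) (HG' : metric_on U' G').
Local Notation oU := (metric_on_open HG).
Local Notation oU' := (metric_on_open HG').
Local Notation Gsym := (metric_on_sym HG).
Local Notation Gsym' := (metric_on_sym HG').
Local Notation A := (conn G).
Local Notation A' := (conn G').
Context (T : 'rV[R]_n -> 'rV[R]_n) (sT : forall l, smooth_on U (fun x => T x 0 l)).
Context (TU : forall x, U x -> U' (T x)).
Implicit Types (x y : 'rV[R]_n) (i j k l p q : 'I_n) (h u : 'rV[R]_n -> R).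

Definition jacT x : 'M[R]_n := \matrix_(k, l) pd k (fun y => T y 0 l) x.

Context (GT : forall x, U x -> G x = jacT x *m G' (T x) *m (jacT x)^T).

Lemma jacTE x k l : jacT x k l = pd k (fun y => T y 0 l) x.
Proof. exact: mxE. Qed.

Lemma smooth_jacT : smooth_mx U jacT.
Proof.
move=> k l; apply: smooth_eq (smooth_pd oU k (sT l)) => [|x _]; first exact: oU.
by rewrite jacTE.
Qed.

Lemma pd_comp h i x : smooth_on U' h -> U x ->
  derivable (h \o T) x (delta_mx 0 i) /\
  pd i (h \o T) x = \sum_m jacT x i m * pd m h (T x).
Proof.
move=> sh Ux.
have dT : derivable T x (delta_mx 0 i).
  by apply/derivable_mxP => a b; rewrite ord1; exact: smooth_derivable (sT b) Ux.
have dh : differentiable h (T x) := smooth_differentiable oU' sh (TU Ux).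
have [d D] := chain_rule dh dT; split=> //.
rewrite pdE /pderiv D (differentiable_deriveE _ dh); apply: eq_bigr => m _.
by rewrite derive_mx // mxE jacTE !pdE.
Qed.

Lemma derivable_mx_comp m r (F : 'rV[R]_n -> 'M[R]_(m, r)) i x : smooth_mx U' F -> U x ->
  derivable_mx x i (fun y => F (T y)).
Proof. by move=> sF Ux a b; have [] := pd_comp i (sF a b) Ux. Qed.

Lemma dM_comp m r (F : 'rV[R]_n -> 'M[R]_(m, r)) i x : smooth_mx U' F -> U x ->
  dM x i (fun y => F (T y)) = \sum_q jacT x i q *: dM (T x) q F.
Proof.
move=> sF Ux; apply/matrixP => a b; rewrite dME summxE.
have [_ E] := pd_comp i (sF a b) Ux; apply: etrans E _.
by apply: eq_bigr => q _; rewrite [RHS]mxE dME.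
Qed.

Lemma jacT_unit x : U x -> jacT x \in unitmx.
Proof.
by move=> Ux; have := metric_unit HG Ux; rewrite GT // !unitmx_mul => /andP[/andP[]].
Qed.

(** Uniqueness of the Levi-Civita connection: the difference of two candidates, with its index
    lowered, is symmetric in one pair of arguments and antisymmetric in an overlapping pair. *)
Lemma conn_unique x (C : 'I_n -> 'M[R]_n) : U x ->
  (forall i j l, C i l j = C j l i) ->
  (forall i, dM x i G = (C i)^T *m G x + G x *m C i) ->
  forall i, C i = A i x.
Proof.
move=> Ux Cs CG i; have Gu := metric_unit HG Ux.
pose t i j k := (G x *m (A i x - C i)) k j.
have t1 a b c : t a b c = t b a c.
  rewrite /t mxE [RHS]mxE; apply: eq_bigr => l _; congr (_ * _).
  by rewrite !(mxDE, mxNE) (conn_sym HG a b l Ux) Cs.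
have t2 a b c : t a b c = - t a c b.
  have := CG a; rewrite (dM_metric HG a Ux) => /eqP.
  rewrite -subr_eq0 opprD addrACA -mulmxBl -mulmxBr.
  rewrite (_ : (A a x)^T - (C a)^T = (A a x - C a)^T); last by rewrite linearB.
  rewrite -[X in _ *m X + _](Gsym Ux) -trmx_mul => /eqP/matrixP/(_ c b).
  by rewrite mxDE [_^T _ _]mxE [RHS]mxE addrC => /eqP; rewrite addr_eq0 => /eqP.
(* Alternating the two transpositions three times restores the order of the arguments and leaves the
   sign -1. *)
have t0 a b c : t a b c = 0.
  have : t a b c = - t a b c by rewrite {1}t1 t2 t1 t2 t1 t2 !opprK.
  by move: (t a b c) => z; lra.
have : G x *m (A i x - C i) = 0 by apply/matrixP => k j; rewrite [RHS]mxE; exact: t0.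
move=> E; have : A i x - C i = 0 by rewrite -(mulKmx Gu (A i x - C i)) E mulmx0.
by move/eqP; rewrite subr_eq0 => /eqP.
Qed.

Local Notation K := (fun x => (jacT x)^T).
(** The pull-back along [T] of the connection form of [G']. *)
Definition connT i x : 'M[R]_n := \sum_m jacT x i m *: A' m (T x).
Local Notation B := connT.

Lemma smooth_K : smooth_mx U K.
Proof. exact (smooth_mxT oU smooth_jacT). Qed.

Lemma dK_sym x i j l : U x -> dM x i K l j = dM x j K l i.
Proof.
move=> Ux; rewrite !dME.
have E a b : pd a (fun y => (jacT y)^T l b) x = pd a (pd b (fun y => T y 0 l)) x.
  by apply: pd_eq => y; rewrite mxE jacTE.
by rewrite !E (pdC oU i j (sT l) Ux).
Qed.

(** Instead of transforming the Christoffel formula, one checks that K^-1 (B K + dK) is torsion-free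
    and compatible with [G], and concludes by [conn_unique]. *)
Lemma conn_change i x : U x -> K x *m A i x = B i x *m K x + dM x i K.
Proof.
move=> Ux; have Ju := jacT_unit Ux; have Ku : K x \in unitmx by rewrite unitmx_tr.
pose X a := B a x *m K x + dM x a K.
have XS a b l : X a l b = X b l a.
  rewrite /X !mxDE (dK_sym a b l Ux); congr (_ + _).
  have E c d : (B c x *m K x) l d = \sum_m \sum_q jacT x c m * jacT x d q * A' m (T x) l q.
    rewrite mxE exchange_big /=; apply: eq_bigr => q _.
    rewrite summxE mulr_suml; apply: eq_bigr => m _.
    by rewrite mxE [_^T q d]mxE; ring.
  rewrite !E exchange_big; apply: eq_bigr => q _; apply: eq_bigr => m _.
  by rewrite (conn_sym HG' m q l (TU Ux)); ring.
suff -> : A i x = invmx (K x) *m X i by rewrite mulKVmx.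
apply/esym; apply: (@conn_unique x (fun a => invmx (K x) *m X a)) => // [a b l|a].
  by rewrite !mxE; apply: eq_bigr => p _; rewrite XS.
have dK : derivable_mx x a K := smooth_mx_derivable smooth_K Ux.
have dJ : derivable_mx x a jacT := smooth_mx_derivable smooth_jacT Ux.
have dG' : derivable_mx x a (fun y => G' (T y)) := derivable_mx_comp (metric_on_smooth HG') Ux.
rewrite (dM_on oU a GT Ux) (dMM (derivable_mxM dJ dG') dK) (dMM dJ dG').
have EK : dM x a jacT = (dM x a K)^T by rewrite dMT trmxK.
have EG : dM x a (fun y => G' (T y)) = (B a x)^T *m G' (T x) + G' (T x) *m B a x.
  rewrite (dM_comp a (metric_on_smooth HG') Ux) linear_sum /= mulmx_suml mulmx_sumr -big_split /=.
  apply: eq_bigr => m _; rewrite (dM_metric HG' m (TU Ux)) scalerDr linearZ /=.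
  by rewrite scalemxAl scalemxAr.
rewrite EK EG (GT Ux) trmx_mul !mulmxA.
have E1 : (X a)^T *m (invmx (K x))^T *m jacT x *m G' (T x) *m K x = (X a)^T *m G' (T x) *m K x.
  by rewrite -trmx_inv trmxK -(mulmxA (X a)^T) mulVmx // mulmx1.
have E2 : jacT x *m G' (T x) *m K x *m invmx (K x) *m X a = jacT x *m G' (T x) *m X a.
  by rewrite -(mulmxA (jacT x *m _)) mulmxV // mulmx1.
rewrite E1 E2 /X trmxD trmx_mul trmxK !mulmxDl !mulmxDr !mulmxA.
move: (jacT x) (G' (T x)) (B a x) (dM x a K) => J g b d.
by apply/matrixP => p q; rewrite !mx_lin_simp; ring.
Qed.

Lemma connTE j y a b : B j y a b = \sum_m jacT y j m * A' m (T y) a b.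
Proof. by rewrite summxE; apply: eq_bigr => m _; rewrite [LHS]mxE. Qed.

Lemma derivable_connT_term i j m a b x : U x ->
  derivable (fun y => jacT y j m * A' m (T y) a b) x (delta_mx 0 i).
Proof.
move=> Ux; apply: derivableM; first exact (smooth_derivable (smooth_jacT j m) Ux).
by have [] := pd_comp i (smooth_conn HG' m a b) Ux.
Qed.

Lemma derivable_connT i j x : U x -> derivable_mx x i (B j).
Proof.
move=> Ux a b; apply: derivable_eq (fun y => esym (connTE j y a b)) _.
by apply: derivable_bigsum => m; exact: derivable_connT_term.
Qed.

Lemma dM_connT i j x a b : U x -> dM x i (B j) a b =
  \sum_m pd i (fun y => jacT y j m) x * A' m (T x) a b
  + \sum_p \sum_m jacT x i p * jacT x j m * dM (T x) p (A' m) a b.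
Proof.
move=> Ux; rewrite dME (pd_eq _ _ (fun y => connTE j y a b)).
rewrite pd_sum => [|m]; last exact: derivable_connT_term.
rewrite [X in _ = _ + X]exchange_big -big_split /=; apply: eq_bigr => m _.
have [d E] := pd_comp i (smooth_conn HG' m a b) Ux.
rewrite (pdM (smooth_derivable (smooth_jacT j m) Ux) d); congr (_ + _).
apply: etrans (congr1 _ E) _; rewrite mulr_sumr; apply: eq_bigr => p _.
by rewrite dME; ring.
Qed.

(** The curvature of a pull-back is the pull-back of the curvature; the second derivatives of [T]
    cancel by their symmetry. *)
Lemma curv_connT i j x a b : U x ->
  (dM x i (B j) - dM x j (B i) + (B i x *m B j x - B j x *m B i x)) a b =
  \sum_p \sum_m jacT x i p * jacT x j m * curv G' p m (T x) a b.
Proof.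
move=> Ux.
have S m : pd i (fun y => jacT y j m) x = pd j (fun y => jacT y i m) x.
  have E c d : pd c (fun y => jacT y d m) x = pd c (pd d (fun y => T y 0 m)) x.
    by apply: pd_eq => y; rewrite jacTE.
  by rewrite !E (pdC oU i j (sT m) Ux).
have P c d : (B c x *m B d x) a b =
    \sum_p \sum_m jacT x c p * jacT x d m * (A' p (T x) *m A' m (T x)) a b.
  rewrite {1}/connT mulmx_suml summxE; apply: eq_bigr => p _.
  rewrite mulmx_sumr summxE; apply: eq_bigr => m _.
  by rewrite -scalemxAl -scalemxAr scalerA [LHS]mxE.
have W f : \sum_p \sum_m jacT x j p * jacT x i m * f p m =
    \sum_p \sum_m jacT x i p * jacT x j m * f m p :> R.
  rewrite exchange_big; apply: eq_bigr => p _; apply: eq_bigr => m _.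
  by rewrite [jacT x j m * _]mulrC.
rewrite !(mxDE, mxNE) !dM_connT // !P !W.
rewrite (eq_bigr (fun m => pd j (fun y => jacT y i m) x * A' m (T x) a b)) => [|m _]; last by rewrite S.
rewrite [X in X - _ + _]addrC addrKA -!sumrB -big_split /=; apply: eq_bigr => p _.
rewrite -!sumrB -big_split /=; apply: eq_bigr => m _.
by rewrite curv_def !(mxDE, mxNE); ring.
Qed.

Lemma curv_change i j x l k : U x -> (K x *m curv G i j x) l k =
  \sum_q (\sum_p \sum_m jacT x i p * jacT x j m * curv G' p m (T x) l q) * jacT x k q.
Proof.
move=> Ux.
have dK a : derivable_mx x a K := smooth_mx_derivable smooth_K Ux.
have ddK a b : derivable_mx x a (fun y => dM y b K) := smooth_mx_derivable (smooth_dM oU b smooth_K) Ux.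
have dA a b : derivable_mx x a (A b) := smooth_mx_derivable (smooth_conn HG b) Ux.
have dB a b : derivable_mx x a (B b) := derivable_connT Ux.
have D a b : dM x a K *m A b x + K x *m dM x a (A b) =
    (dM x a (B b) *m K x + B b x *m dM x a K) + dM x a (fun y => dM y b K).
  rewrite -(dMM (dK a) (dA a b)) (dM_on oU a (fun y Uy => @conn_change b y Uy) Ux).
  by rewrite (dMD (derivable_mxM (dB a b) (dK a)) (ddK a b)) (dMM (dB a b) (dK a)).
have Dj := D j i; rewrite (dMC oU j i smooth_K Ux) in Dj.
rewrite curv_def (curvature_gauge_alg (conn_change i Ux) (conn_change j Ux) (D i j) Dj).
by rewrite mxE; apply: eq_bigr => q _; rewrite curv_connT // [_^T q k]mxE.
Qed.

(** The inverse Jacobian from the upper index of the curvature meets the Jacobian of the traced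
    direction index and cancels it ([F]), so two Jacobian factors remain. *)
Lemma ric_change x : U x -> ric G x = jacT x *m ric G' (T x) *m (jacT x)^T.
Proof.
move=> Ux; have Ju := jacT_unit Ux; have Ku : K x \in unitmx by rewrite unitmx_tr.
apply/matrixP => j k; rewrite ric.unlock ricciE.
have E i : curv G i j x i k = \sum_l invmx (K x) i l *
  (\sum_q (\sum_p \sum_m jacT x i p * jacT x j m * curv G' p m (T x) l q) * jacT x k q).
  rewrite -[curv G i j x in LHS](mulKmx Ku) mxE; apply: eq_bigr => l _.
  by rewrite curv_change.
rewrite (eq_bigr _ (fun i _ => E i)).
have F p l : \sum_i invmx (K x) i l * jacT x i p = (p == l)%:R.
  have /matrixP/(_ p l) := mulmxV Ku; rewrite [RHS]mxE => <-.
  by rewrite mxE; apply: eq_bigr => i _; rewrite [_^T p i]mxE mulrC.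
transitivity (\sum_m \sum_q jacT x j m * (\sum_l curv G' l m (T x) l q) * jacT x k q); last first.
  rewrite mxE exchange_big; apply: eq_bigr => q _ /=; rewrite [_^T q k]mxE [in RHS]mxE mulr_suml.
  by apply: eq_bigr => m _; rewrite ricciE.
transitivity (\sum_l \sum_q \sum_p \sum_m (\sum_i invmx (K x) i l * jacT x i p) *
    (jacT x j m * curv G' p m (T x) l q * jacT x k q)).
  rewrite exchange_big; apply: eq_bigr => l _ /=.
  under eq_bigr => i _ do rewrite mulr_sumr.
  rewrite exchange_big; apply: eq_bigr => q _ /=.
  under eq_bigr => i _ do rewrite mulr_suml mulr_sumr.
  rewrite exchange_big; apply: eq_bigr => p _ /=.
  under eq_bigr => i _ do rewrite mulr_suml mulr_sumr.
  rewrite exchange_big; apply: eq_bigr => m _ /=.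
  by rewrite mulr_suml; apply: eq_bigr => i _; ring.
transitivity (\sum_l \sum_q \sum_m jacT x j m * curv G' l m (T x) l q * jacT x k q).
  apply: eq_bigr => l _; apply: eq_bigr => q _.
  rewrite (bigD1 l) //= [X in _ + X]big1 ?addr0 => [|p pl].
    by apply: eq_bigr => m _; rewrite F eqxx mul1r.
  by apply: big1 => m _; rewrite F (negPf pl) mul0r.
rewrite exchange_big; under eq_bigr => q _ do rewrite exchange_big.
rewrite exchange_big; apply: eq_bigr => m _; apply: eq_bigr => q _ /=.
by rewrite mulr_sumr mulr_suml.
Qed.

Lemma metric_inv_change x : U x ->
  invmx (G x) = invmx (K x) *m invmx (G' (T x)) *m invmx (jacT x).
Proof.
move=> Ux; have Ju := jacT_unit Ux; have Ku : K x \in unitmx by rewrite unitmx_tr.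
have Gu := metric_unit HG Ux; have Gu' := metric_unit HG' (TU Ux).
rewrite -[RHS](mulmxK Gu) {2}(GT Ux) !mulmxA mulmxKV // -!mulmxA (mulmxA (invmx (G' _))) mulVmx //.
by rewrite mul1mx mulmxA mulVmx // mul1mx.
Qed.

Lemma scal_change x : U x -> scal G x = scal G' (T x).
Proof.
move=> Ux; have Ju := jacT_unit Ux; have Ku : K x \in unitmx by rewrite unitmx_tr.
rewrite scal.unlock /trace_mx (ric_change Ux) (metric_inv_change Ux).
rewrite -!mulmxA (mulmxA (invmx (jacT x))) mulVmx // mul1mx mxtrace_mulC -!mulmxA.
by rewrite mulmxV // mulmx1.
Qed.

Lemma grad2_change u x : smooth_on U' u -> U x -> grad2 G (u \o T) x = grad2 G' u (T x).
Proof.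
move=> su Ux; have Ju := jacT_unit Ux; have Ku : K x \in unitmx by rewrite unitmx_tr.
have E : dcol (u \o T) x = jacT x *m dcol u (T x).
  apply/colP => i; rewrite dcolE; have [_ D] := pd_comp i su Ux; apply: etrans D _.
  by rewrite mxE; apply: eq_bigr => m _; rewrite dcolE.
rewrite !grad2_inv E (metric_inv_change Ux) /bilin !trmx_mul !trmxK -!mulmxA.
by rewrite (mulmxA (invmx (jacT x))) mulVmx // mul1mx (mulmxA (K x)) mulmxV // mul1mx.
Qed.
End ChangeOfCoordinates.

(** * Passage to the manifold *)

Section Charts.
Context {R : realType} {n : nat} {M : topologicalType} {S : smooth_manifold R n M}.
Implicit Types (c d : chart R n M) (p q : M) (x : 'rV[R]_n).

Lemma chart_map_cts c p : chart_dom c p -> {for p, continuous (chart_map c)}.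
Proof.
move=> cp; have := @chart_map_continuous _ _ _ c.
by rewrite (continuous_open_subspace _ (@chart_dom_open _ _ _ c)) => /(_ p); apply; rewrite inE.
Qed.

Lemma chart_inv_cts c x : chart_img c x -> {for x, continuous (chart_inv c)}.
Proof.
move=> cx; have := @chart_inv_continuous _ _ _ c.
by rewrite (continuous_open_subspace _ (@chart_img_open _ _ _ c)) => /(_ x); apply; rewrite inE.
Qed.

Lemma chart_invK c x : chart_img c x -> chart_dom c (chart_inv c x) /\ chart_map c (chart_inv c x) = x.
Proof. by move=> [p cp <-]; rewrite chart_mapK. Qed.

Lemma chart_mem c p : chart_dom c p -> chart_img c (chart_map c p).
Proof. by move=> cp; exists p. Qed.

Lemma overlapP c d x : overlap c d x <-> chart_img c x /\ chart_dom d (chart_inv c x).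
Proof.
split=> [[p [cp dp] <-]|[cx dx]]; first by rewrite chart_mapK //; split=> //; exact: chart_mem.
have [cp E] := chart_invK cx; by exists (chart_inv c x).
Qed.

Lemma overlap_open c d : open (overlap c d).
Proof.
rewrite openE => x /overlapP[cx dx].
have n1 : nbhs x (chart_img c) by exact: open_nbhs_nbhs (conj (@chart_img_open _ _ _ c) cx).
have n2 : \forall y \near x, chart_dom d (chart_inv c y).
  apply: (chart_inv_cts cx); exact: open_nbhs_nbhs (conj (@chart_dom_open _ _ _ d) dx).
by apply: filterS (filterI n1 n2) => y [y1 y2]; apply/overlapP.
Qed.

(** The link between a function on [M], to which compactness and connectedness apply, and its smooth
    expressions in the charts, where it is differentiated. *)
Definition chart_rep (F : M -> R) (Fl : chart R n M -> 'rV[R]_n -> R) :=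
  forall c, atlas S c -> smooth_on (chart_img c) (Fl c) /\
    forall p, chart_dom c p -> F p = Fl c (chart_map c p).

Lemma chart_rep_exists (Fl : chart R n M -> 'rV[R]_n -> R) :
  (forall c, atlas S c -> smooth_on (chart_img c) (Fl c)) ->
  (forall c d p, atlas S c -> atlas S d -> chart_dom c p -> chart_dom d p ->
     Fl c (chart_map c p) = Fl d (chart_map d p)) ->
  exists F, chart_rep F Fl.
Proof.
move=> sF cF.
have [k Hk] : exists k : M -> chart R n M, forall p, atlas S (k p) /\ chart_dom (k p) p.
  have ex p : exists c, atlas S c /\ chart_dom c p.
    by have [c] := atlas_cover S p; exists c.
  by exists (fun p => sval (cid (ex p))) => p; exact: svalP (cid (ex p)).
exists (fun p => Fl (k p) (chart_map (k p) p)) => c Sc; split; first exact: sF.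
by move=> p cp; have [Sk kp] := Hk p; exact: cF.
Qed.

Section ChartRep.
Context (F : M -> R) (Fl : chart R n M -> 'rV[R]_n -> R) (HF : chart_rep F Fl).

Lemma chart_rep_continuous : continuous F.
Proof.
move=> p; have [c Sc cp] := atlas_cover S p; have [sF eF] := HF Sc.
have c1 : {for p, continuous (Fl c \o chart_map c)}.
  apply: continuous_comp; first exact: chart_map_cts.
  by apply: smooth_continuous sF _; exact: chart_mem.
rewrite /prop_for /continuous_at (eF _ cp); apply: cvg_trans c1.
apply: near_eq_cvg.
by apply: filterS (open_nbhs_nbhs (conj (@chart_dom_open _ _ _ c) cp)) => q /eF.
Qed.

Lemma chart_rep_max : compact [set: M] -> inhabited M ->
  exists p, forall q, F q <= F p.
Proof.
move=> cM [p0].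
have cF : {within [set: M], continuous F} by apply/continuous_subspaceT/chart_rep_continuous.
have [p _ Hp] := compact_EVT_max (ex_intro _ p0 I) cM cF.
by exists p => q; apply: Hp; rewrite inE.
Qed.

Lemma chart_rep_inv c x : atlas S c -> chart_img c x -> Fl c x = F (chart_inv c x).
Proof. by move=> /HF[_ eF] /chart_invK[cp E]; rewrite (eF _ cp) E. Qed.

Lemma chart_rep_max_pd c p i : atlas S c -> chart_dom c p -> (forall q, F q <= F p) ->
  pd i (Fl c) (chart_map c p) = 0.
Proof.
move=> Sc cp Hp; have [sF eF] := HF Sc; have cx := chart_mem cp.
apply: (local_max_pd (@chart_img_open _ _ _ c) sF cx).
apply: filterS (open_nbhs_nbhs (conj (@chart_img_open _ _ _ c) cx)) => y cy.
by rewrite -(eF _ cp) (chart_rep_inv Sc cy).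
Qed.
End ChartRep.
End Charts.

Section Global.
Context {R : realType} {n : nat} {M : topologicalType} {S : smooth_manifold R n M}.
Context (g : riemannian_metric S).
Implicit Types (c d : chart R n M) (p q : M) (x : 'rV[R]_n).
Local Notation G c := (metric_mx g c).

Lemma chart_metric c : atlas S c -> metric_on (chart_img c) (G c).
Proof.
move=> Sc; split; first exact: chart_img_open.
- exact: metric_smooth.
- exact: Defs.metric_sym.
- exact: metric_posdef.
Qed.

Section Transition.
Context (c d : chart R n M) (Sc : atlas S c) (Sd : atlas S d).
Local Notation T := (chart_map d \o chart_inv c).

Lemma overlap_metric : metric_on (overlap c d) (G c).
Proof.
have sub x : overlap c d x -> chart_img c x by move=> /overlapP[].
have H := chart_metric Sc; split; first exact: overlap_open.
- move=> i j s x /sub; exact: metric_on_smooth H i j s x.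
- by move=> x /sub; exact: metric_on_sym H x.
- by move=> x /sub; exact: metric_on_posdef H x.
Qed.

Lemma transition_img x : overlap c d x -> chart_img d (T x).
Proof. by move=> /overlapP[_]; exact: chart_mem. Qed.

Lemma transition_smooth l : smooth_on (overlap c d) (fun x => T x 0 l).
Proof. exact: atlas_smooth Sc Sd l. Qed.

Lemma transition_metric x : overlap c d x -> G c x = jacT T x *m G d (T x) *m (jacT T x)^T.
Proof.
move=> ox; rewrite (metric_change g Sc Sd ox).
suff -> : transition_jac c d x = jacT T x by [].
by apply/matrixP => k l; rewrite mxE jacTE pdE.
Qed.

Lemma scal_transition p : chart_dom c p -> chart_dom d p ->
  scal (G c) (chart_map c p) = scal (G d) (chart_map d p).
Proof.
move=> cp dp; have ox : overlap c d (chart_map c p) by exists p.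
rewrite (scal_change overlap_metric (chart_metric Sd) transition_smooth transition_img
  transition_metric ox) /=.
by rewrite chart_mapK.
Qed.

Lemma grad2_transition (f : M -> R) p : smooth_function S f -> chart_dom c p -> chart_dom d p ->
  grad2 (G c) (f \o chart_inv c) (chart_map c p) =
  grad2 (G d) (f \o chart_inv d) (chart_map d p).
Proof.
move=> sf cp dp; have ox : overlap c d (chart_map c p) by exists p.
have := grad2_change overlap_metric (chart_metric Sd) transition_smooth transition_img
  transition_metric (sf d Sd) ox.
rewrite /= chart_mapK // => <-.
rewrite !grad2_inv; suff -> : dcol (f \o chart_inv c) (chart_map c p) =
  dcol ((f \o chart_inv d) \o T) (chart_map c p) by [].
have E y : overlap c d y -> (f \o chart_inv c) y = ((f \o chart_inv d) \o T) y.
  by move=> [q [cq dq] <-] /=; rewrite !chart_mapK.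
apply/colP => i; rewrite !dcolE; exact (pd_on (@overlap_open _ _ _ c d) i E ox).
Qed.
End Transition.

Section Eigenfunction.
Context (Mcompact : compact [set: M]) (Mconnected : connected [set: M]).
Context (Ric_ge : ricci_ge g (n%:R - 1)) (f : M -> R) (f_smooth : smooth_function S f).
Context (f_neq0 : exists p : M, f p <> 0) (f_eigen : laplace_eigen g n%:R f).
Local Notation fl c := (f \o chart_inv c).

Lemma eigen_chart c x : atlas S c -> chart_img c x -> lap (G c) (fl c) x = - (n%:R * fl c x).
Proof.
move=> Sc cx; have [cp E] := chart_invK cx.
have := f_eigen Sc cp; rewrite /laplacian /metric /hessian E => /eqP.
by rewrite eqr_oppLR lap.unlock hess.unlock => /eqP.
Qed.

Lemma ricci_chart c x (v : 'rV[R]_n) : atlas S c -> chart_img c x ->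
  (n%:R - 1) * bilin (G c x) v v <= bilin (ric (G c) x) v v.
Proof.
move=> Sc cx; have [cp E] := chart_invK cx.
by have := Ric_ge Sc cp v; rewrite /metric /ricci E ric.unlock.
Qed.

(** Positivity of the constant is read off at a point where [f] does not vanish. *)
Lemma obata_constant : exists2 m : R, 0 < m &
  forall c x, atlas S c -> chart_img c x -> obata (G := G c) (fl c) x = m.
Proof.
have [P HP] : exists P, chart_rep (S := S) P (fun c => obata (G := G c) (fl c)).
  apply: chart_rep_exists => [c Sc|c d p Sc Sd cp dp].
    exact: smooth_obata (chart_metric Sc) _ (f_smooth Sc).
  by rewrite /obata (grad2_transition Sc Sd f_smooth cp dp) /= !chart_mapK.
have [p0 fp0] := f_neq0.
have [p Hp] := chart_rep_max HP Mcompact (inhabits p0).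
have cP := chart_rep_continuous HP.
(* The set where the maximum is attained is open by the strong maximum principle, read in a chart,
   and closed by continuity. *)
have PE : [set q | P q = P p] = [set: M].
  apply: Mconnected; first by exists p.
  - exists [set q | P q = P p]; last by rewrite setTI.
    rewrite openE => q /= Pq; have [c Sc cq] := atlas_cover S q.
    have [sF eF] := HP c Sc; have cx := chart_mem cq.
    have HG := chart_metric Sc.
    have loc : \forall y \near chart_map c q, obata (G := G c) (fl c) y = P p.
      apply: (strong_max_local HG sF cx) => [x cx'|x cx'|].
      + apply: (lap_obata_ge0 HG (f_smooth Sc)) => //.
          by move=> y cy; exact: eigen_chart.
        by move=> v; exact: ricci_chart.
      + by rewrite (chart_rep_inv HP Sc cx'); exact: Hp.
      + by rewrite -(eF _ cq).
    have n1 : \forall z \near q, obata (G := G c) (fl c) (chart_map c z) = P p.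
      have cc : chart_map c @ q --> chart_map c q by exact: chart_map_cts.
      exact: (cc _ loc).
    have n2 : nbhs q (chart_dom c) by exact: open_nbhs_nbhs (conj (@chart_dom_open _ _ _ c) cq).
    by apply: filterS (filterI n1 n2) => z [z1 z2]; rewrite /= (eF _ z2).
  - exists [set q | P q = P p]; last by rewrite setTI.
    apply: (@preimage_closed _ _ P [set t | t = P p]); first by move=> q _; exact: cP.
    exact: closed_eq.
have Pc q : P q = P p by have : [set: M] q by []; rewrite -PE.
exists (P p).
  rewrite -(Pc p0); have [c Sc cp0] := atlas_cover S p0; have [_ eF] := HP c Sc.
  rewrite (eF _ cp0) /obata /= chart_mapK // ltr_wpDl //.
    exact: grad2_ge0 (chart_metric Sc) _ _ (chart_mem cp0).
  by rewrite -expr2 exprn_even_gt0 //=; apply/eqP.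
by move=> c x Sc cx; rewrite (chart_rep_inv HP Sc cx).
Qed.

(** Since [P] is constant, every point is a local maximum and its Laplacian is at most 0; Bochner
    gives the opposite inequality, and equality forces the Hessian. *)
Lemma hess_chart c x : atlas S c -> chart_img c x -> hess (G c) (fl c) x = - fl c x *: G c x.
Proof.
move=> Sc cx; have HG := chart_metric Sc; have [m _ Hm] := obata_constant.
apply: (lap_obata_eq0 HG (f_smooth Sc) (fun y => @eigen_chart c y Sc) cx).
  by move=> v; exact: ricci_chart.
apply/eqP; rewrite eq_le; apply/andP; split.
  apply: (lap_local_max (metric_on_open HG) (smooth_obata HG (f_smooth Sc)) cx _ HG).
  apply: filterS (open_nbhs_nbhs (conj (@chart_img_open _ _ _ c) cx)) => y cy.
  by rewrite !Hm.
apply: (lap_obata_ge0 HG (f_smooth Sc) (fun y => @eigen_chart c y Sc) cx).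
by move=> v; exact: ricci_chart.
Qed.

Definition excess c x : R := scal (G c) x - n%:R * (n%:R - 1).

Lemma smooth_excess c : atlas S c -> smooth_on (chart_img c) (excess c).
Proof.
move=> Sc; have HG := chart_metric Sc.
exact (smoothB (metric_on_open HG) (smooth_scal HG) (smooth_cst _)).
Qed.

Lemma trace_excess c x : atlas S c -> chart_img c x ->
  trace_mx (G c x) (ric (G c) x - (n%:R - 1) *: G c x) = excess c x.
Proof.
move=> Sc cx; have HG := chart_metric Sc.
rewrite /excess scal.unlock /trace_mx mulmxBr linearB /= -scalemxAr mulVmx; last exact (metric_unit HG cx).
by rewrite linearZ /= mxtrace1 [X in _ - X]mulrC.
Qed.

Lemma excess_zero : forall c x, atlas S c -> chart_img c x -> excess c x = 0.
Proof.
have [m m0 Hm] := obata_constant.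
(* [e] will be 1 or -1, so that minima of [s f] are treated as maxima of its negative. *)
pose Fl (e : R) c x := e * (excess c x * fl c x).
have sFl e c : atlas S c -> smooth_on (chart_img c) (Fl e c).
  move=> Sc; have oc := metric_on_open (chart_metric Sc).
  exact (smoothM oc (smooth_cst e) (smoothM oc (smooth_excess Sc) (f_smooth Sc))).
(* V(s f) = 2 f^2 s + s |V|^2, and |V|^2 = m - f^2. *)
have along e c x : atlas S c -> chart_img c x ->
    \sum_a grad (G c) (fl c) x a 0 * pd a (Fl e c) x
    = e * (excess c x * (fl c x * fl c x + m)).
  move=> Sc cx; have HG := chart_metric Sc; have oc := metric_on_open HG.
  have sx := smooth_excess Sc; have sf := f_smooth Sc.
  have D a : pd a (Fl e c) x = e * (pd a (scal (G c)) x * fl c x + excess c x * pd a (fl c) x).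
    rewrite (pdM (smooth_derivable (smooth_cst e) cx) (smooth_derivable (smoothM oc sx sf) cx)).
    rewrite pd_cst mul0r add0r (pdM (smooth_derivable sx cx) (smooth_derivable sf cx)).
    congr (_ * (_ * _ + _)).
    apply: etrans (pdD (smooth_derivable (smooth_scal HG) cx)
      (smooth_derivable (smooth_cst (- (n%:R * (n%:R - 1)))) cx)) _.
    by rewrite pd_cst addr0.
  rewrite -(Hm _ _ Sc cx) /obata.
  have E1 := scal_concircular HG sf (fun y => @hess_chart c y Sc) cx.
  have E2 := grad2_sum (G := G c) (fl c) x.
  transitivity (e * (fl c x * \sum_a grad (G c) (fl c) x a 0 * pd a (scal (G c)) x
     + excess c x * \sum_a pd a (fl c) x * grad (G c) (fl c) x a 0)).
    rewrite !mulr_sumr -big_split mulr_sumr /=; apply: eq_bigr => a _.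
    by rewrite D /=; ring.
  by rewrite E1 -E2 /excess; ring.
have crit e c x : e != 0 -> atlas S c -> chart_img c x ->
    (forall a, pd a (Fl e c) x = 0) -> excess c x = 0.
  move=> e0 Sc cx D; have := along e c x Sc cx.
  rewrite big1 => [/esym/eqP|a _]; last by rewrite D mulr0.
  rewrite mulf_eq0 (negPf e0) mulf_eq0 /= => /orP[/eqP //|/eqP H].
  have : 0 < fl c x * fl c x + m by rewrite ltr_wpDl // -expr2 sqr_ge0.
  by rewrite H ltxx.
have rep e : exists F, chart_rep (S := S) F (Fl e).
  apply: chart_rep_exists => [c|c d p Sc Sd cp dp]; first exact: sFl.
  by rewrite /Fl /excess (scal_transition Sc Sd cp dp) /= !chart_mapK.
have le0 e c x : e != 0 -> atlas S c -> chart_img c x -> Fl e c x <= 0.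
  move=> e0 Sc cx; have [F HF] := rep e.
  have [p0 _] := f_neq0.
  have [p Hp] := chart_rep_max HF Mcompact (inhabits p0).
  have [d Sd dp] := atlas_cover S p; have [_ eF] := HF d Sd.
  have z : excess d (chart_map d p) = 0.
    apply: (crit e) => //; first exact: chart_mem.
    by move=> a; exact: chart_rep_max_pd HF d p a Sd dp Hp.
  by rewrite (chart_rep_inv HF Sc cx) (le_trans (Hp _)) // (eF _ dp) /Fl z mul0r mulr0.
(* Both signs together give [s f = 0] identically, so its derivatives vanish at every point and
   [crit] yields [s = 0] even at the zeros of [f]. *)
move=> c x Sc cx; apply: (crit 1) => //.
have Z y : chart_img c y -> Fl 1 c y = 0.
  move=> cy; apply/eqP; rewrite eq_le le0 ?oner_neq0 //=.
  by have := le0 (-1) c y; rewrite oppr_eq0 oner_neq0 /Fl mulN1r mul1r oppr_le0; apply.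
move=> a; rewrite (pd_on (@chart_img_open _ _ _ c) a Z cx).
exact: pd_cst.
Qed.

Lemma ric_eq c x : atlas S c -> chart_img c x -> ric (G c) x = (n%:R - 1) *: G c x.
Proof.
move=> Sc cx; have HG := chart_metric Sc; apply/eqP; rewrite -subr_eq0; apply/eqP.
apply: (trace_mx_psd_eq0 (metric_on_sym HG cx) (metric_on_posdef HG cx)).
- by rewrite linearB /= (ric_tr HG cx) linearZ /= (metric_on_sym HG cx).
- move=> v; have := ricci_chart v Sc cx; rewrite -subr_ge0.
  congr (0 <= _); rewrite /bilin mulmxBr mulmxBl mxDE mxNE -scalemxAr -scalemxAl.
  by congr (_ - _); rewrite [RHS]mxE.
- by rewrite trace_excess // excess_zero.
Qed.

Lemma eigen_einstein : einstein g.
Proof.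
move=> c p Sc cp; have cx := chart_mem cp; have HG := chart_metric Sc.
have rE : ricci_mx (G c) (chart_map c p) = (n%:R - 1) *: G c (chart_map c p).
  by have := ric_eq Sc cx; rewrite ric.unlock.
rewrite /ricci0 /scalar_curvature /ricci /metric rE /trace_mx -scalemxAr mulVmx; last first.
  exact (metric_unit HG cx).
(* The quotient of [n * (n - 1)] by [n] is [n - 1] only for nonzero [n]; in dimension zero the
   matrices are empty. *)
have [n0|n0] := eqVneq n 0%N.
  by apply/matrixP => i; have := ltn_ord i; rewrite [X in (_ < X)%N]n0.
by rewrite mxtraceZ mxtrace1 mulfK ?pnatr_eq0 // subrr.
Qed.
End Eigenfunction.
End Global.

Theorem proposition2p4 (R : realType) (n : nat) (M : topologicalType)
    (S : smooth_manifold R n M) (g : riemannian_metric S)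
    (Mcompact : compact [set: M]) (Mconnected : connected [set: M])
    (Ric_ge : ricci_ge g (n%:R - 1))
    (f : M -> R) (f_smooth : smooth_function S f)
    (f_neq0 : exists p : M, f p <> 0)
    (f_eigen : laplace_eigen g n%:R f) :
  einstein g.
Proof. exact: eigen_einstein f_eigen. Qed.
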